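(* Consider the $\mathbb Z/2\mathbb Z$-graded algebra $A=\langle1,\xi\rangle/(\xi^2=1)$, $\bar\xi=1$, over a field $k$ of characteristic $0$, with the odd scalar product $g(1,\xi)=1$, the odd derivation $I(\xi)=1$ (so $I(1)=0$, $I^2=0$), and the homotopy inverse $\widetilde I(1)=\xi$, $\widetilde I(\xi)=0$. Let $G$ be the ribbon graph with three vertices $a,b,t$ and five edges, with $a,b$ of valence $3$ and $t$ of valence $4$, given by $$\sigma=(a_1\,a_2\,a_3)(b_1\,b_2\,b_3)(t_1\,t_2\,t_3\,t_4),\qquad \eta=(a_1t_1)(b_1t_3)(a_2b_2)(a_3b_3)(t_2t_4),$$ so that two opposite flags of $t$ form a loop and $G$ represents a surface of genus $1$ with $2$ punctures. Then, for either orientation of $G$, $$Z_{\widetilde I}(\partial G)\neq0 ,$$ where $\partial=D$ is the differential of the ribbon graph complex and $Z_{\widetilde I}$ is the cochain whose value on an oriented ribbon graph is its partition function.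
   Context: **Ribbon graph complex.** A ribbon graph $G$ is a finite set $Flag(G)$ with a permutation $\sigma$ all of whose cycles have length $\ge3$ (the cycles are the vertices; $Flag(v)$ has a cyclic order; $n(v)=|Flag(v)|$) and a fixed-point free involution $\eta$ (its orbits are the edges). An orientation $or(G)$ is an orientation of $\bigotimes_{v}(k^{Flag(v)}\oplus k)$ (tensor product of determinant lines); equivalently, a choice of a flag at each even-valent vertex and an order on the set of even-valent vertices (the wedge over vertices $v=(f_1\dots f_r)$ of $v\wedge f_1\wedge\dots\wedge f_r$). The complex is spanned by connected $(G,or(G))$ modulo $(G,-or)=-(G,or)$, with $D(G,or(G))=\sum_e(G/\{e\},\text{induced orientation})$, sum over edges that are not loops, where for $e=(ff')$ joining $v_1\ni f$ and $v_2\ni f'$ the cycles $(f\,A)$ and $(f'\,B)$ are replaced by $v_0=(A\,B)$, with induced orientation $v_1\wedge f\wedge v_2\wedge f'\wedge\omega\mapsto v_0\wedge\omega$. **Partition function.** For $P:A\to\Pi\,\mathrm{Hom}(A,k)$ induced by $g$, $g^{-1}(\varphi,\psi)=g(P^{-1}\varphi,P^{-1}\psi)$, $\widetilde I^*\varphi(a)=(-1)^{\bar\varphi}\varphi(\widetilde Ia)$, put $g^{-1}_{\widetilde I}(\varphi,\psi)=g^{-1}(\widetilde I^*\varphi,\psi)$, an element of $(\Pi A)^{\otimes2}$, with copy $(g^{-1}_{\widetilde I})_e$ for each edge $e$. Put $\alpha_n(\pi a_1,\dots,\pi a_n)=(-1)^{\sum_{i=1}^{n-1}\sum_{j=1}^i\bar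 a_j}g(a_1\cdots a_{n-1},a_n)$, which is $(-1)^{n+1}$-cyclically symmetric, and let $\alpha_v$ be its copy in $\mathrm{Hom}((\Pi A)^{\otimes Flag(v)},k)$ with $n=n(v)$ (for even $n(v)$ starting from the chosen flag). $\pi a\in\Pi A$ is $a$ with reversed parity. The value of $Z_{\widetilde I}$ on $(G,or(G))$ is $Z^{G,or(G)}_{\widetilde I}=\langle\bigotimes_v\alpha_v,\bigotimes_e(g^{-1}_{\widetilde I})_e\rangle$, the odd factors $\alpha_v$ ($n(v)$ even) being multiplied in the order given by $or(G)$. Thus $Z_{\widetilde I}(\partial G)=\sum_{e}Z^{G/\{e\},or(G/\{e\})}_{\widetilde I}$, sum over the non-loop edges. *)

(* Defs.v *)
From HB Require Import structures.
From mathcomp Require Import all_boot all_order all_fingroup all_algebra all_field.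
From mathcomp Require Import ring.

Set Implicit Arguments.
Unset Strict Implicit.
Unset Printing Implicit Defensive.

Import GRing.Theory.
Local Open Scope ring_scope.

(** ** Ribbon graphs *)

Record ribbon_graph := RibbonGraph {
  flag : finType;
  sigma : {perm flag};
  eta : {perm flag};
  sigma_ge3 : forall f, (2 < #|porbit sigma f|)%N;
  eta_inv : involutive eta;
  eta_free : forall f, eta f != f
}.

Definition vertex (G : ribbon_graph) (f : flag G) : {set flag G} :=
  porbit (sigma G) f.

Definition vertices (G : ribbon_graph) : {set {set flag G}} :=
  porbits (sigma G).

Definition valence (G : ribbon_graph) (f : flag G) : nat := #|vertex f|.

Definition adjacent (G : ribbon_graph) : rel (flag G) :=
  fun f h => (h == sigma G f) || (h == eta G f).

Definition connected (G : ribbon_graph) : Prop :=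
  exists f : flag G, forall h, connect (@adjacent G) f h.

(* The boundary components of the surface are the cycles of f |-> eta (sigma f);
   mathcomp composes permutations from left to right. *)
Definition punctures (G : ribbon_graph) : nat :=
  #|porbits (sigma G * eta G)%g|.

(* V - E + F = 2 - 2 g, with the negative terms moved to the other side. *)
Definition has_genus (G : ribbon_graph) (g : nat) : Prop :=
  (#|vertices G| + punctures G + 2 * g = #|porbits (eta G)| + 2)%N.

(** ** Signs *)

(* The exponent of the Koszul sign of the rearrangement of the word s into the
   word t: the number of pairs of odd letters whose order is reversed.  When
   all letters are odd this computes the sign of the permutation. *)
Definition koszul (T : eqType) (isodd : pred T) (s t : seq T) : nat :=
  \sum_(x <- s) \sum_(y <- s)
    [&& isodd x, isodd y, index x s < index y s & index y t < index x t]%N.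

(** ** Orientations *)

(* The tensor product over v of the determinant lines of k^Flag(v) (+) k is the
   top exterior power of the space with basis Flag(G) (flags, inl) and the set
   of vertices (inr).  An orientation is represented by a signed wedge monomial
   (-1)^osign x_1 /\ ... /\ x_N in which every basis element occurs once. *)
Definition cell (G : ribbon_graph) : Type := (flag G + {set flag G})%type.

HB.instance Definition _ (G : ribbon_graph) := Equality.on (cell G).

Definition cells (G : ribbon_graph) : seq (cell G) :=
  [seq inl f | f <- enum (flag G)] ++ [seq inr v | v <- enum (vertices G)].

Record orientation (G : ribbon_graph) := Orientation {
  osign : bool;
  oword : seq (cell G);
  oword_cells : perm_eq oword (cells G)
}.

(** ** Edge contraction *)

Section RibbonTheory.

Variable G : ribbon_graph.
Implicit Types x y : flag G.

Lemma vertex_sigma x : vertex (sigma G x) = vertex x.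
Proof. exact: (porbit_perm _ 1). Qed.

Lemma sigma_neq x : sigma G x != x.
Proof.
apply: contraTneq (sigma_ge3 x) => sx; rewrite -leqNgt.
suff: porbit (sigma G) x \subset [set x].
  by move/subset_leq_card; rewrite cards1 => /leq_trans->.
apply/subsetP=> y /porbitP[i ->]; rewrite inE; elim: i => [|i IH].
  by rewrite expg0 perm1.
by rewrite expgSr permM (eqP IH) sx.
Qed.

Lemma sigma2_neq x : sigma G (sigma G x) != x.
Proof.
apply: contraTneq (sigma_ge3 x) => sx; rewrite -leqNgt.
suff: porbit (sigma G) x \subset [set x; sigma G x].
  by move/subset_leq_card/leq_trans; apply; rewrite cards2; case: eqP.
apply/subsetP=> y /porbitP[i ->]; rewrite !inE; elim: i => [|i IH].
  by rewrite expg0 perm1 eqxx.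
rewrite expgSr permM; case/orP: IH => /eqP->; first by rewrite eqxx orbT.
by rewrite sx eqxx.
Qed.

End RibbonTheory.

Lemma porbit_ge3 (T : finType) (s : {perm T}) x :
  s x != x -> s (s x) != x -> (2 < #|porbit s x|)%N.
Proof.
move=> sx ssx; have <-: #|[:: x; s x; s (s x)]| = 3%N.
  apply/card_uniqP; rewrite /= !inE negb_or eq_sym sx eq_sym ssx eq_sym.
  by rewrite (inj_eq perm_inj) sx.
apply/subset_leq_card/subsetP=> y; rewrite !inE => /or3P[]/eqP->.
- exact: porbit_id.
- exact: (mem_porbit s 1).
- by have := mem_porbit s 2 x; rewrite expgS expg1 permM.
Qed.

Lemma pmap_uniq_in (S T : eqType) (p : S -> option T) (s : seq S) :
    {in s &, forall x y, p x = p y -> p x -> x = y} ->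
  uniq s -> uniq (pmap p s).
Proof.
elim: s => //= x s IH pI /andP[xs us].
have {IH} ups: uniq (pmap p s).
  by apply: IH us => y z ys zs; apply: pI; rewrite inE ?ys ?zs orbT.
case px: (p x) => [u|] //=; rewrite ups andbT mem_pmap.
apply: contra xs => /mapP[y ys uy].
by rewrite (pI x y) ?px -?uy ?inE ?eqxx ?ys ?orbT.
Qed.

Section Contraction.

Variables (G : ribbon_graph) (f : flag G).
Let f' : flag G := eta G f.
Hypothesis nloop : vertex f != vertex f'.

Definition cflag : finType := {x : flag G | x \notin [:: f; f']}.

(* The cycles (f A) and (f' B) become (A B): the last flag of A is followed by
   the first flag sigma f' of B, the last flag of B by the first flag sigma f
   of A. *)
Definition csigma_val (x : flag G) : flag G :=
  if sigma G x == f then sigma G f'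
  else if sigma G x == f' then sigma G f
  else sigma G x.

Lemma f'_neq : f' != f. Proof. exact: eta_free. Qed.

Lemma sigma_f_neq' : sigma G f != f'.
Proof. by apply: contraNneq nloop => <-; rewrite vertex_sigma. Qed.

Lemma sigma_f'_neq : sigma G f' != f.
Proof. by apply: contraNneq nloop => {1}<-; rewrite vertex_sigma. Qed.

Lemma csigma_valP x : csigma_val x \notin [:: f; f'].
Proof.
rewrite /csigma_val !inE negb_or.
have [_|xf] := eqVneq (sigma G x) f; first by rewrite sigma_f'_neq sigma_neq.
have [_|x2] := eqVneq (sigma G x) f'.
  by rewrite sigma_f_neq' sigma_neq.
by rewrite xf.
Qed.

Definition csigma_fun (x : cflag) : cflag := Sub (csigma_val (val x)) (csigma_valP _).

Lemma csigma_inj : injective csigma_fun.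
Proof.
move=> [x xP] [y yP] /(congr1 val) /= exy; apply: val_inj => /=.
move: xP yP exy; rewrite /csigma_val !inE !negb_or => /andP[xf xf'] /andP[yf yf'].
have sI := @perm_inj _ (sigma G).
case: (altP (sigma G x =P f)) => [x1|x1]; case: (altP (sigma G y =P f)) => [y1|y1].
- by move=> _; apply: sI; rewrite x1 y1.
- case: (altP (sigma G y =P f')) => [y2 /sI ff|y2 /sI yE].
    by move: f'_neq; rewrite ff eqxx.
  by rewrite yE eqxx in yf'.
- case: (altP (sigma G x =P f')) => [x2 /sI ff|x2 /sI xE].
    by move: f'_neq; rewrite -ff eqxx.
  by rewrite xE eqxx in xf'.
case: (altP (sigma G x =P f')) => [x2|x2]; case: (altP (sigma G y =P f')) => [y2|y2].
- by move=> _; apply: sI; rewrite x2 y2.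
- by move/sI=> yE; rewrite yE eqxx in yf.
- by move/sI=> xE; rewrite xE eqxx in xf.
- exact: sI.
Qed.

Definition csigma : {perm cflag} := perm csigma_inj.

Lemma ceta_valP (x : cflag) : eta G (val x) \notin [:: f; f'].
Proof.
case: x => x /=; rewrite !inE !negb_or => /andP[xf xf'].
by rewrite -{1}[f](eta_inv f) !(inj_eq perm_inj) xf xf'.
Qed.

Definition ceta_fun (x : cflag) : cflag := Sub (eta G (val x)) (ceta_valP x).

Lemma ceta_funK : involutive ceta_fun.
Proof. by move=> x; apply: val_inj; rewrite /= eta_inv. Qed.

Definition ceta : {perm cflag} := perm (inv_inj ceta_funK).

Lemma val_csigma x : val (csigma x) = csigma_val (val x).
Proof. by rewrite permE. Qed.

Lemma cflagP (x : cflag) : (val x != f) && (val x != f').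
Proof. by case: x => x /=; rewrite !inE negb_or. Qed.

Lemma csigma_ge3 (x : cflag) : (2 < #|porbit csigma x|)%N.
Proof.
have /andP[xf xf'] := cflagP x.
have sI := @perm_inj _ (sigma G).
have vneq a b : vertex a = vertex f -> vertex b = vertex f' -> a != b.
  by move=> va vb; apply: contraNneq nloop => ab; rewrite -va -vb ab.
have vs := @vertex_sigma G; have s2 := @sigma2_neq G.
have vE a b : sigma G a = b -> vertex a = vertex b by move<-; rewrite vs.
have stay b : vertex b = vertex f -> (b == f') = false.
  by move=> vb; apply: contraNF nloop => /eqP <-; rewrite vb.
have stay' b : vertex b = vertex f' -> (b == f) = false.
  by move=> vb; apply: contraNF nloop => /eqP <-; rewrite vb.
apply: porbit_ge3; rewrite -val_eqE !val_csigma /csigma_val.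
  have [/vE x1|_] := eqVneq (sigma G (val x)) f.
    by rewrite eq_sym; apply: vneq; rewrite ?vs.
  have [/vE x2|_] := eqVneq (sigma G (val x)) f'; last exact: sigma_neq.
  by apply: vneq; rewrite ?vs.
have [/vE x1|_] := eqVneq (sigma G (val x)) f.
  rewrite stay' ?vs // (negPf (s2 _)) eq_sym.
  by apply: vneq; rewrite ?vs.
have [/vE x2|_] := eqVneq (sigma G (val x)) f'.
  rewrite (negPf (s2 _)) stay ?vs //.
  by apply: vneq; rewrite ?vs.
have [/vE x3|_] := eqVneq (sigma G (sigma G (val x))) f.
  by rewrite eq_sym; apply: vneq; rewrite -?x3 ?vs.
have [/vE x3|_] := eqVneq (sigma G (sigma G (val x))) f'; last exact: s2.
by apply: vneq; rewrite -?x3 ?vs.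
Qed.

Lemma ceta_inv : involutive ceta.
Proof. by move=> x; rewrite !permE ceta_funK. Qed.

Lemma ceta_free x : ceta x != x.
Proof. by rewrite permE -val_eqE /= eta_free. Qed.

Definition contract : ribbon_graph := RibbonGraph csigma_ge3 ceta_inv ceta_free.


Lemma first_flagP : sigma G f \notin [:: f; f'].
Proof. by rewrite !inE negb_or sigma_neq sigma_f_neq'. Qed.

Definition first_flag : cflag := Sub (sigma G f) first_flagP.

Definition merged (x : flag G) : bool :=
  (vertex x == vertex f) || (vertex x == vertex f').

Lemma csigma_porbit x y : (csigma y \in porbit csigma x) = (y \in porbit csigma x).
Proof. by rewrite -!eq_porbit_mem (porbit_perm _ 1). Qed.

Lemma merged_csigma x : merged (val (csigma x)) = merged (val x).
Proof.
rewrite val_csigma /csigma_val /merged.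
have vs := @vertex_sigma G.
have vE a b : sigma G a = b -> vertex a = vertex b by move<-; rewrite vs.
have [/vE ->|_] := eqVneq (sigma G (val x)) f; first by rewrite vs !eqxx orbT.
have [/vE ->|_] := eqVneq (sigma G (val x)) f'; first by rewrite vs !eqxx orbT.
by rewrite vs.
Qed.

Lemma merged_porbit x y : y \in porbit csigma x -> merged (val y) = merged (val x).
Proof.
case/porbitP=> i ->{y}; elim: i => [|i IH]; first by rewrite expg0 perm1.
by rewrite expgSr permM merged_csigma.
Qed.

Lemma merged_first x : merged (val x) -> x \in porbit csigma first_flag.
Proof.
have step h b : (forall c : cflag, val c = sigma G h -> c \in porbit csigma first_flag) ->
    h = f \/ h = f' -> vertex (val b) = vertex h -> b \in porbit csigma first_flag.
  move=> h1 hf vb.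
  suff H i (c : cflag) : val c = (sigma G ^+ i.+1)%g h -> c \in porbit csigma first_flag.
    have /porbitP[[|i] bE] : val b \in porbit (sigma G) h.
      by rewrite -eq_porbit_mem -/(vertex _) vb eqxx.
      by have := cflagP b; rewrite bE expg0 perm1; case: hf => ->; rewrite eqxx ?andbF.
    exact: H bE.
  elim: i c => [|i IH] c; first by rewrite expg1; apply: h1.
  rewrite expgSr permM; set z := (sigma G ^+ i.+1)%g h => cz.
  have vz : vertex z = vertex h by rewrite /vertex /z porbit_perm.
  have [zh|zh] := eqVneq z h; first by apply: h1; rewrite cz zh.
  have zP : z \notin [:: f; f'].
    rewrite !inE negb_or; case: hf => hE; move: zh vz; rewrite hE => -> vz /=.
      by apply: contraNneq nloop => <-; rewrite vz.
    by rewrite andbT; apply: contraNneq nloop => <-; rewrite vz.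
  pose zc : cflag := Sub z zP.
  suff <- : csigma zc = c by rewrite csigma_porbit; apply: IH.
  apply: val_inj; rewrite val_csigma /= /csigma_val -cz.
  by have := cflagP c; case/andP => /negPf-> /negPf->.
have stepf b : vertex (val b) = vertex f -> b \in porbit csigma first_flag.
  apply: step; last by left.
  by move=> c cE; have -> : c = first_flag; [apply: val_inj | apply: porbit_id].
case/orP => /eqP; first exact: stepf.
apply: step; last by right.
move=> c cE.
pose z := (sigma G)^-1%g f.
have zE : sigma G z = f by rewrite permKV.
have vz : vertex z = vertex f by rewrite -(vertex_sigma z) zE.
have zP : z \notin [:: f; f'].
  rewrite !inE negb_or; apply/andP; split.
    by apply: contraTneq (sigma_neq f) => zf; rewrite negbK -{1}zf zE.
  by apply: contraNneq nloop => <-; rewrite vz.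
pose zc : cflag := Sub z zP.
suff <- : csigma zc = c by rewrite csigma_porbit; apply: stepf.
by apply: val_inj; rewrite val_csigma /= /csigma_val zE eqxx.
Qed.

Lemma merged_porbitE x y : merged (val x) -> (y \in porbit csigma x) = merged (val y).
Proof.
move=> mx; apply/idP/idP => [/merged_porbit->//|my].
have /eqP <- : porbit csigma first_flag == porbit csigma x.
  by rewrite eq_sym eq_porbit_mem merged_first.
exact: merged_first.
Qed.

Lemma unmerged_porbitE x y : ~~ merged (val x) ->
  (y \in porbit csigma x) = (val y \in vertex (val x)).
Proof.
move=> mx; have H i : val ((csigma ^+ i)%g x) = (sigma G ^+ i)%g (val x).
  elim: i => [|i IH]; first by rewrite !expg0 !perm1.
  rewrite !expgSr !permM val_csigma IH /csigma_val; set z := (sigma G ^+ i)%g (val x).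
  have vz : vertex (sigma G z) = vertex (val x).
    by rewrite vertex_sigma /vertex /z porbit_perm.
  by rewrite !ifF //; apply: contraNF mx => /eqP zE; rewrite /merged -vz zE eqxx ?orbT.
apply/porbitP/porbitP => [][i yE]; exists i; first by rewrite yE H.
by apply: val_inj; rewrite H.
Qed.

Definition new_vertex : {set cflag} := vertex (G := contract) first_flag.

(* The image in the contracted graph of a cell other than the two contracted
   flags and their vertices; only such cells are fed to it. *)
Definition push (c : cell G) : option (cell contract) :=
  match c with
  | inl x => omap (@inl (flag contract) {set flag contract}) (insub x)
  | inr v => Some (inr [set y : cflag | val y \in v])
  end.

Definition contracted_cells : seq (cell G) :=
  [:: inr (vertex f); inl f; inr (vertex f'); inl f'].

Definition other_cells (o : orientation G) : seq (cell G) :=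
  [seq c <- oword o | c \notin contracted_cells].

Definition induced_word (o : orientation G) : seq (cell contract) :=
  inr new_vertex :: pmap push (other_cells o).

Lemma mem_cells (H : ribbon_graph) (c : cell H) :
  (c \in cells H) = if c is inr v then v \in vertices H else true.
Proof.
rewrite mem_cat; case: c => [x|v].
  by rewrite map_f ?mem_enum.
rewrite orbC mem_map ?mem_enum; last by move=> ? ? [].
by case: (v \in vertices H) => //=; apply/negP => /mapP[].
Qed.

Lemma uniq_cells (H : ribbon_graph) : uniq (cells H).
Proof.
have uf : uniq [seq @inl _ {set flag H} x | x <- enum (flag H)].
  by rewrite map_inj_uniq ?enum_uniq // => ? ? [].
have uv : uniq [seq @inr (flag H) _ v | v <- enum (vertices H)].
  by rewrite map_inj_uniq ?enum_uniq // => ? ? [].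
rewrite cat_uniq uf uv andbT; apply/hasPn => _ /mapP[v _ ->].
by apply/negP => /mapP[].
Qed.

Lemma mem_other (o : orientation G) (c : cell G) : c \in other_cells o ->
  if c is inr v then exists2 x : cflag, v = vertex (val x) & ~~ merged (val x)
  else True.
Proof.
rewrite mem_filter (perm_mem (oword_cells o)) mem_cells; case: c => [//|v].
case/andP=> + /imsetP[x _ vE]; rewrite !inE => nv; have {}vE : v = vertex x by [].
have mx : ~~ merged x.
  by apply: contra nv; rewrite /merged vE => /orP[]/eqP ->; rewrite eqxx ?orbT.
have xP : x \notin [:: f; f'].
  by apply: contra mx; rewrite !inE /merged => /orP[]/eqP ->; rewrite eqxx ?orbT.
by exists (Sub x xP).
Qed.

Lemma induced_word_cells o : perm_eq (induced_word o) (cells contract).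
Proof.
apply: uniq_perm (uniq_cells _) _.
  rewrite /= mem_pmap; apply/andP; split.
    apply/negP => /mapP[[x|v] /mem_other /=]; first by case: insub.
    move=> [x -> mx] [/setP/(_ first_flag)]; rewrite inE porbit_id -unmerged_porbitE // => /esym.
    by move/merged_porbit; rewrite (negPf mx) /merged /= vertex_sigma eqxx.
  apply: pmap_uniq_in; last by rewrite filter_uniq // (perm_uniq (oword_cells o)) uniq_cells.
  move=> [x|v] [y|w] /mem_other /= vx /mem_other /= wy.
  - case: insubP => //= u _ <-; case: insubP => //= u' _ <-.
    by case=> ->.
  - by case: insub.
  - by case: insub.
  case: vx wy => x -> _ [y -> _] [] /setP/(_ x); rewrite !inE /vertex porbit_id.
  by move/esym; rewrite -eq_porbit_mem => /eqP->.
move=> c; rewrite mem_cells inE mem_pmap; case: c => [x|v] /=.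
  apply/mapP; exists (inl (val x)); last by rewrite /= valK.
  rewrite mem_filter (perm_mem (oword_cells o)) mem_cells andbT !inE.
  have /andP[xf xf'] := cflagP x.
  apply/negP => /or4P[]// /eqP[] xE; first by case/eqP: xf.
  by case/eqP: xf'.
apply/orP/imsetP => [[/eqP[->]|/mapP[[x|w] /mem_other /=]]|[x _ ->]].
- by exists first_flag.
- by case: insub.
- move=> [x -> mx] [->]; exists x => //.
  by apply/setP => y; rewrite inE unmerged_porbitE.
have [mx|mx] := boolP (merged (val x)).
  left; apply/eqP; congr inr; apply/eqP; rewrite /new_vertex /vertex /=.
  by rewrite eq_porbit_mem merged_first.
right; apply/mapP; exists (inr (vertex (val x))).
  rewrite mem_filter (perm_mem (oword_cells o)) mem_cells imset_f // andbT.
  rewrite !inE; apply: contra mx => /or4P[]// /eqP[] xE.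
    by rewrite /merged xE eqxx.
  by rewrite /merged xE eqxx orbT.
by congr (Some (inr _)); apply/setP => y; rewrite inE unmerged_porbitE.
Qed.

(* v_1 /\ f /\ v_2 /\ f' /\ w |-> v_0 /\ w. *)
Definition induced_orientation (o : orientation G) : orientation contract :=
  Orientation
    (osign o (+)
     odd (koszul predT (oword o) (contracted_cells ++ other_cells o)))
    (induced_word_cells o).

Lemma contract_connected : connected G -> connected contract.
Proof.
case=> x0 cx0.
have retP x : (if (x == f) || (x == f') then sigma G f else x) \notin [:: f; f'].
  case: ifP => [_|/negbT]; first exact: first_flagP.
  by rewrite !inE.
pose ret x : cflag := Sub (if (x == f) || (x == f') then sigma G f else x) (retP x).
have valret x : x \notin [:: f; f'] -> val (ret x) = x.
  by rewrite !inE /= => /negPf->.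
have retE (x : cflag) : ret (val x) = x.
  by apply: val_inj; apply: valret; exact: valP x.
have cporbit x y : y \in porbit csigma x -> connect (@adjacent contract) x y.
  case/porbitP => i ->; elim: i => [|i IH]; first by rewrite expg0 perm1.
  apply: connect_trans IH (connect1 _).
  by rewrite expgSr permM /adjacent eqxx.
have mret x : merged x -> merged (val (ret x)).
  by rewrite /=; case: ifP => // _ _; rewrite /merged vertex_sigma eqxx.
have unm x : ~~ merged x -> x \notin [:: f; f'].
  by apply: contra; rewrite !inE /merged => /orP[]/eqP ->; rewrite eqxx ?orbT.
exists (ret x0) => y; rewrite -(retE y).
have {cx0} /connectP[p] := cx0 (val y); move: (val y) => z.
elim: p x0 => [|x1 p IH] x0 /=; first by move=> _ ->.
case/andP=> adj pp zE; apply: connect_trans (IH _ pp zE) => {IH p pp z zE y}.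
case/orP: adj => /eqP ->.
  have [mx|mx] := boolP (merged x0).
    apply: cporbit; rewrite merged_porbitE; apply: mret => //.
    by move: mx; rewrite /merged vertex_sigma.
  have mx' : ~~ merged (sigma G x0) by rewrite /merged vertex_sigma.
  apply: cporbit; rewrite unmerged_porbitE ?valret ?unm //.
  by rewrite porbit_sym -eq_porbit_mem -!/(vertex _) vertex_sigma.
have [->|xf] := eqVneq x0 f.
  have -> : ret (eta G f) = ret f by apply: val_inj; rewrite /= !eqxx orbT.
  exact: connect0.
have [->|xf'] := eqVneq x0 f'.
  have -> : ret (eta G f') = ret f'.
    by apply: val_inj; rewrite /= eta_inv !eqxx orbT.
  exact: connect0.
apply: connect1; apply/orP; right; apply/eqP/val_inj.
have xP : x0 \notin [:: f; f'] by rewrite !inE negb_or xf.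
rewrite /= permE /= (negPf xf) (negPf xf') /= ifF //.
by apply/negbTE; have := ceta_valP (ret x0); rewrite valret // !inE.
Qed.

End Contraction.

(** ** The ribbon graph complex *)

Record ograph := OGraph {
  graph : ribbon_graph;
  graph_connected : connected graph;
  orient : orientation graph
}.

(* One flag in each edge. *)
Definition edge_flags (G : ribbon_graph) : seq (flag G) := enum (froots (eta G)).

Definition nonloop_edge (G : ribbon_graph) : finType :=
  {f : flag G | (f \in froots (eta G)) && (vertex f != vertex (eta G f))}.

Lemma nonloop_edgeP (G : ribbon_graph) (e : nonloop_edge G) :
  vertex (val e) != vertex (eta G (val e)).
Proof. by case: e => f /= /andP[]. Qed.

Definition contract_edge (X : ograph) (e : nonloop_edge (graph X)) : ograph :=
  OGraph (contract_connected (nonloop_edgeP e) (graph_connected X))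
         (induced_orientation (nonloop_edgeP e) (orient X)).

(* Formal linear combinations of oriented graphs, before taking the quotient by
   (G, -or) = - (G, or); cochains are functions on oriented graphs that are
   odd under reversal of the orientation, extended linearly. *)
Definition chain (k : fieldType) : Type := seq (k * ograph).

Definition D (k : fieldType) (c : chain k) : chain k :=
  [seq (x.1, contract_edge e) | x <- c, e <- enum {: nonloop_edge (graph x.2)}].

Definition pairing (k : fieldType) (z : ograph -> k) (c : chain k) : k :=
  \sum_(x <- c) x.1 * z x.2.

(** ** Superalgebras with an odd scalar product *)

Record superalgebra (k : fieldType) := Superalgebra {
  alg :> falgType k;
  sdim : nat;
  sbasis : sdim.-tuple alg;
  sbasisP : basis_of fullv sbasis;
  par : 'I_sdim -> bool
}.

(* The element a is homogeneous of parity p. *)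
Definition homog (k : fieldType) (A : superalgebra k) (p : bool) (a : A) : Prop :=
  forall i, par i != p -> coord (sbasis A) i a = 0.

(* A Z/2-graded algebra with an invariant odd scalar product g, an odd
   derivation I and an odd homotopy inverse It of I. *)
Record odd_cyclic_algebra (k : fieldType) := OddCyclicAlgebra {
  salg :> superalgebra k;
  one_even : homog false (1 : salg);
  mul_homog : forall p q (a b : salg),
    homog p a -> homog q b -> homog (p (+) q) (a * b);
  form : salg -> salg -> k;
  form_linl : forall b, scalar (form^~ b);
  form_linr : forall a, scalar (form a);
  form_odd : forall p (a b : salg), homog p a -> homog p b -> form a b = 0;
  form_sym : forall p q (a b : salg), homog p a -> homog q b ->
    form a b = (-1) ^+ (p && q) * form b a;
  form_inv : forall a b c, form (a * b) c = form a (b * c);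
  form_nondeg : forall a, (forall b, form a b = 0) -> a = 0;
  deriv_I : 'End(salg);
  I_odd : forall p (a : salg), homog p a -> homog (~~ p) (deriv_I a);
  I_deriv : forall p (a b : salg), homog p a ->
    deriv_I (a * b) = deriv_I a * b + (-1) ^+ p *: (a * deriv_I b);
  I_sq : forall a, deriv_I (deriv_I a) = 0;
  I_form : forall p (a b : salg), homog p a ->
    form (deriv_I a) b + (-1) ^+ p * form a (deriv_I b) = 0;
  homotopy_It : 'End(salg);
  It_odd : forall p (a : salg), homog p a -> homog (~~ p) (homotopy_It a);
  It_homotopy : forall a, deriv_I (homotopy_It a) + homotopy_It (deriv_I a) = a;
  It_form : forall p (a b : salg), homog p a ->
    form (homotopy_It a) b = (-1) ^+ p * form a (homotopy_It b)
}.

(** ** The partition function *)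

Section PartitionFunction.

Variables (k : fieldType) (A : odd_cyclic_algebra k).

Local Notation label := 'I_(sdim A).

Definition bvec (i : label) : A := tnth (sbasis A) i.

(* The functional dual to the i-th basis vector; it has parity par i. *)
Definition dvec (i : label) : 'Hom(A, k^o) :=
  linfun (coord (sbasis A) i : A -> k^o).

Definition mapP : 'Hom(A, 'Hom(A, k^o)) :=
  linfun (fun a : A => linfun (form a : A -> k^o)).

Definition ginv (phi psi : 'Hom(A, k^o)) : k :=
  form ((mapP^-1)%VF phi) ((mapP^-1)%VF psi).

(* It^* on functionals of parity p. *)
Definition It_dual (p : bool) (phi : 'Hom(A, k^o)) : 'Hom(A, k^o) :=
  (-1) ^+ p *: (phi \o homotopy_It A)%VF.

(* The coefficient of pi e_i (x) pi e_j in g^{-1}_It; this tensor is even and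
   symmetric in the graded sense, so neither the order of the two flags of an
   edge nor the order of the edges matters below. *)
Definition edge_coef (i j : label) : k :=
  ginv (It_dual (par i) (dvec i)) (dvec j).

(* alpha_n (pi a_1, ..., pi a_n) on basis vectors, with a_(i+1) = bvec (x i). *)
Definition alpha (n : nat) (x : nat -> label) : k :=
  (-1) ^+ (\sum_(1 <= i < n) \sum_(0 <= j < i) par (x j)) *
  form (\prod_(0 <= i < n.-1) bvec (x i)) (bvec (x n.-1)).

Variable G : ribbon_graph.
Implicit Types (x : {ffun flag G -> label}) (r : seq (flag G)).

Definition vertex_flags (f : flag G) : seq (flag G) :=
  traject (sigma G) f (valence f).

(* The parity of the basis vector of Pi A put at the flag f. *)
Definition odd_label x (f : flag G) : bool := ~~ par (x f).

(* <alpha_(v_1) (x) ... (x) alpha_(v_m), u_1 (x) ... (x) u_m>, where v_i is the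
   vertex read from the i-th flag of r and u_i the tensor of the basis vectors
   at its flags: u_1 moves past alpha_(v_2), ..., alpha_(v_m), and so on;
   alpha_n has the parity of n + 1. *)
Fixpoint eval_vertices x r : k :=
  if r is f :: r' then
    (-1) ^+ ((\sum_(h <- vertex_flags f) odd_label x h) *
             (\sum_(h <- r') ~~ odd (valence h))) *
    alpha (valence f) (fun i => x ((sigma G ^+ i)%g f)) * eval_vertices x r'
  else 1.

(* The contraction of the alpha_v with the edge tensors, for a choice r of one
   flag in each vertex and of an order on the vertices.  The first sign comes
   from the rearrangement of the factors of the product over the edges (f f')
   of the tensors in the copies of Pi A at f and f'. *)
Definition state_sum r : k :=
  \sum_(x : {ffun flag G -> label})
    (-1) ^+ koszul (odd_label x)
              (flatten [seq [:: f; eta G f] | f <- edge_flags G])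
              (flatten [seq vertex_flags f | f <- r]) *
    eval_vertices x r *
    \prod_(f <- edge_flags G) edge_coef (x f) (x (eta G f)).

(* The wedge over the vertices v = (f_1 ... f_n) of v /\ f_1 /\ ... /\ f_n. *)
Definition vertex_word r : seq (cell G) :=
  flatten [seq inr (vertex f) :: [seq inl h | h <- vertex_flags f] | f <- r].

(* The orientation of G is compared with the one given by one choice of a flag
   in each vertex and an order on the vertices; any other choice multiplies both
   factors by the same sign. *)
Definition Zgraph (o : orientation G) : k :=
  let r := enum (froots (sigma G)) in
  (-1) ^+ (osign o + koszul predT (oword o) (vertex_word r)) * state_sum r.

End PartitionFunction.

Definition Z (k : fieldType) (A : odd_cyclic_algebra k) (X : ograph) : k :=
  Zgraph A (orient X).

(** ** The algebra <1, xi> / (xi^2 = 1) *)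

(* {poly %/ p} has algebra and vector space structures in the library, but not
   their join. *)
HB.instance Definition _ (k : fieldType) (p : {poly k}) := Vector.on {poly %/ p}.

Section Example.

Variable k : fieldType.

Definition xi_alg : falgType k := {poly %/ ('X^2 - 1 : {poly k})}.

Definition xi : xi_alg := 'qX.

Definition xi_coef (i : nat) (a : xi_alg) : k := (a : {poly k})`_i.

Definition xi_basis : 2.-tuple xi_alg := [tuple 1; xi].

Definition xi_par (i : 'I_2) : bool := i == 1%N :> nat.

Lemma xi_monic : ('X^2 - 1 : {poly k}) \is monic.
Proof.
by rewrite -(polyC1 k) monicE lead_coefXnsubC.
Qed.

Lemma xi_size : size ('X^2 - 1 : {poly k}) = 3%N.
Proof. by rewrite -(polyC1 k) size_XnsubC. Qed.

Lemma xi_mk_monic : mk_monic ('X^2 - 1 : {poly k}) = 'X^2 - 1.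
Proof. by rewrite /mk_monic xi_size xi_monic. Qed.

Lemma val_xi : xi = 'X :> {poly k}.
Proof. by apply: qpolyXE; rewrite ?xi_size ?xi_monic. Qed.

Lemma xi_sqr : xi * xi = 1.
Proof.
rewrite /xi /qpolyX -in_qpolyM.
have -> : 'X * 'X = ('X^2 - 1) + 1 :> {poly k} by rewrite subrK -expr2.
rewrite in_qpolyD in_qpoly1 -[RHS]add0r; congr (_ + _).
apply/val_inj; rewrite /= xi_mk_monic.
by rewrite Pdiv.RingMonic.rmodpp ?xi_monic.
Qed.

Lemma xi_coef_lin i : scalar (xi_coef i).
Proof. by move=> c a b; rewrite /xi_coef /= coefD coefZ. Qed.

Lemma xi_coef1 i : xi_coef i 1 = (i == 0%N)%:R.
Proof. by rewrite /xi_coef /= coefC; case: i. Qed.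

Lemma xi_coefX i : xi_coef i xi = (i == 1%N)%:R.
Proof. by rewrite /xi_coef val_xi coefX. Qed.

Lemma xi_decomp (a : xi_alg) : a = xi_coef 0 a *: 1 + xi_coef 1 a *: xi.
Proof.
apply: val_inj => /=; apply/polyP => i.
rewrite coefD !coefZ -!/(xi_coef _ _) -/(xi_coef i 1) -/(xi_coef i xi) xi_coef1 xi_coefX.
case: i => [|[|i]] /=; rewrite ?mulr1 ?mulr0 ?addr0 ?add0r //.
rewrite /xi_coef nth_default //; apply: leq_trans (size_npoly a) _.
by rewrite xi_mk_monic xi_size.
Qed.


Lemma xi_basisP : basis_of fullv xi_basis.
Proof.
have span : (fullv <= <<xi_basis>>)%VS.
  apply/subvP => a _; rewrite (xi_decomp a).
  by rewrite memvD ?memvZ // memv_span // !inE eqxx ?orbT.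
by rewrite basisEdim span dimvf /dim /= xi_mk_monic xi_size.
Qed.

Definition xi_superalgebra : superalgebra k :=
  Superalgebra xi_basisP xi_par.

Lemma coord_coef (a : xi_alg) i : coord xi_basis i a = xi_coef i a.
Proof.
have lin c u v : coord xi_basis i (c *: u + v) = c * coord xi_basis i u + coord xi_basis i v.
  by rewrite linearP.
have cb j : coord xi_basis i (tnth xi_basis j) = (j == i)%:R.
  by rewrite (tnth_nth 0) coord_free ?(basis_free xi_basisP) // eq_sym.
rewrite {1}(xi_decomp a) lin -[xi_coef 1 a *: xi]addr0 lin linear0 addr0.
have := cb ord0; have := cb (lift ord0 ord0); rewrite !(tnth_nth 0) /= => -> ->.
by case: i lin cb => [[|[|//]] ilt] _ _ /=; rewrite ?mulr1 ?mulr0 ?addr0 ?add0r.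
Qed.

(* g(1, xi) = g(xi, 1) = 1, g(1, 1) = g(xi, xi) = 0. *)
Definition xi_form (a b : xi_alg) : k := xi_coef 0 a * xi_coef 1 b + xi_coef 1 a * xi_coef 0 b.

(* I(1) = 0, I(xi) = 1. *)
Definition xi_I : 'End(xi_alg) := linfun (fun a : xi_alg => xi_coef 1 a *: (1 : xi_alg)).

(* It(1) = xi, It(xi) = 0. *)
Definition xi_It : 'End(xi_alg) := linfun (fun a : xi_alg => xi_coef 0 a *: xi).

Lemma xi_coefD i a b : xi_coef i (a + b) = xi_coef i a + xi_coef i b.
Proof. by rewrite /xi_coef /= coefD. Qed.

Lemma xi_coefZ i c a : xi_coef i (c *: a) = c * xi_coef i a.
Proof. by rewrite /xi_coef /= coefZ. Qed.

Lemma xi_ext (a b : xi_alg) : xi_coef 0 a = xi_coef 0 b -> xi_coef 1 a = xi_coef 1 b -> a = b.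
Proof. by move=> e0 e1; rewrite (xi_decomp a) (xi_decomp b) e0 e1. Qed.

Lemma xi_coef_mul (a b : xi_alg) :
  (xi_coef 0 (a * b) = xi_coef 0 a * xi_coef 0 b + xi_coef 1 a * xi_coef 1 b) *
  (xi_coef 1 (a * b) = xi_coef 0 a * xi_coef 1 b + xi_coef 1 a * xi_coef 0 b).
Proof.
have -> : a * b = (xi_coef 0 a * xi_coef 0 b + xi_coef 1 a * xi_coef 1 b) *: 1 +
    (xi_coef 0 a * xi_coef 1 b + xi_coef 1 a * xi_coef 0 b) *: xi.
  rewrite {1}(xi_decomp a) {1}(xi_decomp b) !mulrDl !mulrDr.
  rewrite -!scalerAl -!scalerAr !mul1r mulr1 xi_sqr !scalerA !scalerDl.
  by rewrite [X in _ + X]addrC addrACA [X in _ + X]addrC.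
by rewrite !xi_coefD !xi_coefZ !xi_coef1 !xi_coefX /= !mulr1 !mulr0 addr0 add0r.
Qed.

Lemma xi_IE a : xi_I a = xi_coef 1 a *: 1.
Proof.
have lin : linear (fun a : xi_alg => xi_coef 1 a *: (1 : xi_alg)).
  by move=> c u v; rewrite xi_coefD xi_coefZ scalerDl scalerA.
pose L : {linear xi_alg -> xi_alg} :=
  HB.pack (fun a : xi_alg => xi_coef 1 a *: (1 : xi_alg)) (GRing.isLinear.Build _ _ _ _ _ lin).
exact: (lfunE L).
Qed.

Lemma xi_ItE a : xi_It a = xi_coef 0 a *: xi.
Proof.
have lin : linear (fun a : xi_alg => xi_coef 0 a *: xi).
  by move=> c u v; rewrite xi_coefD xi_coefZ scalerDl scalerA.
pose L : {linear xi_alg -> xi_alg} :=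
  HB.pack (fun a : xi_alg => xi_coef 0 a *: xi) (GRing.isLinear.Build _ _ _ _ _ lin).
exact: (lfunE L).
Qed.

Lemma xi_homogP p (a : xi_superalgebra) : homog p a -> xi_coef (~~ p) a = 0.
Proof.
move=> h; have lt2 : ((~~ p : nat) < 2)%N by case: p {h}.
rewrite -(coord_coef a (Ordinal lt2)); apply: h.
by case: p lt2.
Qed.

Lemma xi_homog p (a : xi_superalgebra) : xi_coef (~~ p) a = 0 -> homog p a.
Proof.
move=> h i; rewrite /= coord_coef => ip.
suff <- : (~~ p : nat) = i by [].
by move: ip; rewrite /xi_par; case: i p {h} => [[|[|//]] ilt] [].
Qed.

Lemma xi_one_even : homog false (1 : xi_superalgebra).
Proof. by apply: xi_homog; rewrite xi_coef1. Qed.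

Lemma xi_mul_homog p q (a b : xi_superalgebra) :
  homog p a -> homog q b -> homog (p (+) q) (a * b).
Proof.
move=> /xi_homogP ap /xi_homogP bq; apply: xi_homog.
by case: p q ap bq => [] [] /= ap bq; rewrite xi_coef_mul ap bq; ring.
Qed.

Lemma xi_form_linl b : scalar (xi_form^~ b).
Proof. by move=> c u v; rewrite /xi_form !xi_coefD !xi_coefZ; ring. Qed.

Lemma xi_form_linr a : scalar (xi_form a).
Proof. by move=> c u v; rewrite /xi_form !xi_coefD !xi_coefZ; ring. Qed.

Lemma xi_form_odd p (a b : xi_superalgebra) :
  homog p a -> homog p b -> xi_form a b = 0.
Proof.
move=> /xi_homogP ap /xi_homogP bp; rewrite /xi_form.
by case: p ap bp => /= -> ->; ring.
Qed.

Lemma xi_form_sym p q (a b : xi_superalgebra) : homog p a -> homog q b ->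
  xi_form a b = (-1) ^+ (p && q) * xi_form b a.
Proof.
move=> /xi_homogP ap /xi_homogP bq; rewrite /xi_form.
by case: p q ap bq => [] [] /= -> ->; ring.
Qed.

Lemma xi_form_inv a b c : xi_form (a * b) c = xi_form a (b * c).
Proof. by rewrite /xi_form !xi_coef_mul; ring. Qed.

Lemma xi_form_nondeg a : (forall b, xi_form a b = 0) -> a = 0.
Proof.
move=> a0; have := a0 1; have := a0 xi; rewrite /xi_form !xi_coef1 !xi_coefX /=.
rewrite !mulr0 !mulr1 addr0 add0r => e0 e1.
by rewrite (xi_decomp a) e0 e1 !scale0r addr0.
Qed.

Lemma xi_I_odd p (a : xi_superalgebra) : homog p a -> homog (A := xi_superalgebra) (~~ p) (xi_I a).
Proof.
move=> /xi_homogP ap; apply: xi_homog; rewrite negbK xi_IE xi_coefZ xi_coef1.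
by case: p ap => /= ap; rewrite ?ap; ring.
Qed.

Lemma xi_I_deriv p (a b : xi_superalgebra) : homog p a ->
  xi_I (a * b) = xi_I a * b + (-1) ^+ p *: (a * xi_I b).
Proof.
move=> /xi_homogP ap; rewrite !xi_IE; apply: xi_ext;
  rewrite !(xi_coefD, xi_coefZ, xi_coef_mul, xi_coef1);
  by case: p ap => /= ->; ring.
Qed.

Lemma xi_I_sq a : xi_I (xi_I a) = 0.
Proof. by rewrite !xi_IE xi_coefZ xi_coef1 mulr0 scale0r. Qed.

Lemma xi_I_form p (a b : xi_superalgebra) : homog p a ->
  xi_form (xi_I a) b + (-1) ^+ p * xi_form a (xi_I b) = 0.
Proof.
move=> /xi_homogP ap; rewrite !xi_IE /xi_form !(xi_coefZ, xi_coef1).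
by case: p ap => /= ->; ring.
Qed.

Lemma xi_It_odd p (a : xi_superalgebra) : homog p a -> homog (A := xi_superalgebra) (~~ p) (xi_It a).
Proof.
move=> /xi_homogP ap; apply: xi_homog; rewrite negbK xi_ItE xi_coefZ xi_coefX.
by case: p ap => /= ap; rewrite ?ap; ring.
Qed.

Lemma xi_It_homotopy a : xi_I (xi_It a) + xi_It (xi_I a) = a.
Proof.
rewrite !xi_IE !xi_ItE; apply: xi_ext;
  by rewrite !(xi_coefD, xi_coefZ, xi_coef1, xi_coefX) /=; ring.
Qed.

Lemma xi_It_form p (a b : xi_superalgebra) : homog p a ->
  xi_form (xi_It a) b = (-1) ^+ p * xi_form a (xi_It b).
Proof.
move=> /xi_homogP ap; rewrite !xi_ItE /xi_form !(xi_coefZ, xi_coefX).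
by case: p ap => /= ->; ring.
Qed.

Definition xi_algebra : odd_cyclic_algebra k :=
  @OddCyclicAlgebra k xi_superalgebra xi_one_even xi_mul_homog
    xi_form xi_form_linl xi_form_linr xi_form_odd xi_form_sym xi_form_inv
    xi_form_nondeg xi_I xi_I_odd xi_I_deriv xi_I_sq xi_I_form
    xi_It xi_It_odd xi_It_homotopy xi_It_form.

End Example.

(** ** The graph with vertices a, b, t *)

Lemma next_undup_inj (T : eqType) (s : seq T) : injective (next (undup s)).
Proof. exact: can_inj (prev_next (undup_uniq s)). Qed.

(* The cyclic permutation (s_1 s_2 ... s_n). *)
Definition cyc (T : finType) (s : seq T) : {perm T} := perm (@next_undup_inj T s).

Definition a1 : 'I_10 := @Ordinal 10 0 isT.
Definition a2 : 'I_10 := @Ordinal 10 1 isT.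
Definition a3 : 'I_10 := @Ordinal 10 2 isT.
Definition b1 : 'I_10 := @Ordinal 10 3 isT.
Definition b2 : 'I_10 := @Ordinal 10 4 isT.
Definition b3 : 'I_10 := @Ordinal 10 5 isT.
Definition t1 : 'I_10 := @Ordinal 10 6 isT.
Definition t2 : 'I_10 := @Ordinal 10 7 isT.
Definition t3 : 'I_10 := @Ordinal 10 8 isT.
Definition t4 : 'I_10 := @Ordinal 10 9 isT.

Definition abt_sigma : {perm 'I_10} :=
  (cyc [:: a1; a2; a3] * cyc [:: b1; b2; b3] * cyc [:: t1; t2; t3; t4])%g.

Definition abt_eta : {perm 'I_10} :=
  (cyc [:: a1; t1] * cyc [:: b1; t3] * cyc [:: a2; b2] * cyc [:: a3; b3] *
   cyc [:: t2; t4])%g.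

Lemma ord10_ind (P : 'I_10 -> Prop) :
  P a1 -> P a2 -> P a3 -> P b1 -> P b2 -> P b3 -> P t1 -> P t2 -> P t3 -> P t4 ->
  forall i, P i.
Proof.
move=> ? ? ? ? ? ? ? ? ? ? [m mlt].
by do 10 (case: m mlt => [|m] mlt; first by rewrite (bool_irrelevance mlt isT)).
Qed.

Lemma abt_sigmaE : (abt_sigma a1 = a2) * (abt_sigma a2 = a3) * (abt_sigma a3 = a1) *
  (abt_sigma b1 = b2) * (abt_sigma b2 = b3) * (abt_sigma b3 = b1) *
  (abt_sigma t1 = t2) * (abt_sigma t2 = t3) * (abt_sigma t3 = t4) *
  (abt_sigma t4 = t1).
Proof. by rewrite !permM !permE. Qed.

Lemma abt_etaE : (abt_eta a1 = t1) * (abt_eta a2 = b2) * (abt_eta a3 = b3) *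
  (abt_eta b1 = t3) * (abt_eta b2 = a2) * (abt_eta b3 = a3) *
  (abt_eta t1 = a1) * (abt_eta t2 = t4) * (abt_eta t3 = b1) * (abt_eta t4 = t2).
Proof. by rewrite !permM !permE. Qed.

Lemma abt_sigma_ge3 f : (2 < #|porbit abt_sigma f|)%N.
Proof. by apply: porbit_ge3; elim/ord10_ind: f; rewrite !abt_sigmaE. Qed.

Lemma abt_eta_inv : involutive abt_eta.
Proof. by elim/ord10_ind; rewrite !abt_etaE. Qed.

Lemma abt_eta_free f : abt_eta f != f.
Proof. by elim/ord10_ind: f; rewrite !abt_etaE. Qed.

Definition abt_graph : ribbon_graph :=
  RibbonGraph abt_sigma_ge3 abt_eta_inv abt_eta_free.

Lemma abt_connected : connected abt_graph.
Proof.
have cs f : connect (@adjacent abt_graph) a1 f -> connect (@adjacent abt_graph) a1 (abt_sigma f).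
  by move/connect_trans; apply; apply: connect1; rewrite /adjacent eqxx.
have ce f : connect (@adjacent abt_graph) a1 f -> connect (@adjacent abt_graph) a1 (abt_eta f).
  by move/connect_trans; apply; apply: connect1; rewrite /adjacent eqxx orbT.
have c1 : connect (@adjacent abt_graph) a1 a1 by exact: connect0.
have c2 := cs _ c1; rewrite abt_sigmaE in c2; have c3 := cs _ c2; rewrite abt_sigmaE in c3.
have d1 := ce _ c1; rewrite abt_etaE in d1.
have d2 := cs _ d1; rewrite abt_sigmaE in d2; have d3 := cs _ d2; rewrite abt_sigmaE in d3.
have d4 := cs _ d3; rewrite abt_sigmaE in d4.
have e2 := ce _ c2; rewrite abt_etaE in e2; have e3 := ce _ c3; rewrite abt_etaE in e3.
have e1 := ce _ d3; rewrite abt_etaE in e1.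
by exists a1; elim/ord10_ind.
Qed.

(* Main.v *)
From HB Require Import structures.
Require Import Defs.
From mathcomp Require Import all_boot all_order all_fingroup all_algebra all_field.
From mathcomp Require Import ring.

Set Implicit Arguments.
Unset Strict Implicit.
Unset Printing Implicit Defensive.

Import GRing.Theory.
Local Open Scope ring_scope.

(* The edge tensor is - pi xi (x) pi xi, so the only state that contributes is
   the one with all labels xi; there alpha_n takes the value (-1)^C(n, 2) for n
   odd and g(xi, xi) = 0 for n even.  Contracting (a2 b2) or (a3 b3) leaves t of
   valence 4 and contributes 0.  Contracting (a1 t1) or (b1 t3) gives a graph
   with vertices of valence 5 and 3, which contributes +1 or -1.  Both signs
   agree, because the corresponding rearrangement of flags and vertices is even;
   so the sum is 2 or -2. *)

(** * Parity of rearrangements of words *)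

Section Koszul.

Variable T : eqType.
Implicit Types s t u : seq T.

Lemma koszul_map (S : eqType) (h : T -> S) s t : injective h ->
  koszul predT (map h s) (map h t) = koszul predT s t.
Proof.
move=> hI; rewrite /koszul big_map; apply: eq_bigr => x _.
by rewrite big_map; apply: eq_bigr => y _; rewrite !index_map.
Qed.

Lemma koszul_refl s : koszul predT s s = 0%N.
Proof.
by rewrite /koszul big1 // => x _; rewrite big1 // => y _ /=; case: ltngtP.
Qed.

(** The index of a member of [s] separates it from every other letter; a [y] outside [s] has index
    [size s], beyond that of [x]. *)
Lemma index_gtn s x y : x \in s ->
  (index y s < index x s)%N = (x != y) && ~~ (index x s < index y s)%N.
Proof.
move=> xs; have [->|xy] /= := eqVneq; first by rewrite ltnn.
case: ltngtP => // yE; case/eqP: xy; have ys : y \in s by rewrite -index_mem yE index_mem.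
by rewrite -(nth_index x xs) -yE nth_index.
Qed.

(* Modulo 2, the pairs reversed between t and u may be counted over the pairs
   ordered as in s. *)
Lemma odd_koszul_trans s t u : perm_eq s t -> perm_eq s u ->
  odd (koszul predT s u) = odd (koszul predT s t) (+) odd (koszul predT t u).
Proof.
move=> st su.
pose lt (w : seq T) (x y : T) : nat := (index x w < index y w)%N.
have ltC (w : seq T) (x y : T) : perm_eq s w -> x \in s -> x != y ->
    lt w y x = (1 - lt w x y)%N.
  move=> sw xs xy; rewrite /lt index_gtn -?(perm_mem sw) // xy /=.
  by case: (_ < _)%N.
have kE (w v : seq T) : koszul predT w v = (\sum_(x <- w) \sum_(y <- w) lt w x y * lt v y x)%N.
  by apply: eq_bigr => x _; apply: eq_bigr => y _; rewrite /= mulnb.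
have tuE : koszul predT t u = (\sum_(x <- s) \sum_(y <- s)
    lt s x y * (lt t x y * lt u y x + lt t y x * lt u x y))%N.
  (* For distinct letters of [s] the inserted factor is 1. The half with [y] before [x] is then
     reindexed by exchanging the two summation variables. *)
  transitivity (\sum_(x <- s) \sum_(y <- s) (lt s x y + lt s y x) * (lt t x y * lt u y x))%N.
    rewrite kE -(perm_big _ st) /=; apply: eq_big_seq => x xs.
    rewrite -(perm_big _ st) /=; apply: eq_big_seq => y ys.
    have [->|xy] := eqVneq x y; first by rewrite /lt !ltnn.
    rewrite (ltC s x y) // subnKC ?mul1n //.
    by rewrite /lt leq_b1.
  under eq_bigr do under eq_bigr do rewrite mulnDl.
  under [RHS]eq_bigr do under eq_bigr do rewrite mulnDr.
  under eq_bigr do rewrite big_split.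
  under [RHS]eq_bigr do rewrite big_split.
  rewrite !big_split /=; congr (_ + _)%N.
  by rewrite exchange_big.
(* For [x] before [y] in [s], let a and b tell whether the pair is reversed in [t] and in [u]. The
   three counts get a, a xor b and b, whose sum is 2 max(a, b). *)
have sum_even : (koszul predT s t + koszul predT t u + koszul predT s u =
    (\sum_(x <- s) \sum_(y <- s) lt s x y * maxn (lt t y x) (lt u y x)).*2)%N.
  rewrite tuE (kE s t) (kE s u) -muln2 big_distrl -!big_split /=.
  apply: eq_big_seq => x xs; rewrite big_distrl -!big_split /=.
  apply: eq_big_seq => y ys.
  have [->|xy] := eqVneq x y; first by rewrite /lt !ltnn.
  rewrite (ltC t x y) // (ltC u x y) // /lt.
  by case: (index x s < _)%N; case: (index x t < _)%N; case: (index x u < _)%N.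
have := odd_double (\sum_(x <- s) \sum_(y <- s) lt s x y * maxn (lt t y x) (lt u y x))%N.
by rewrite -sum_even !oddD; do 3!case: (odd _).
Qed.

(** Each block stays on its side, so no pair with one letter in each block is reversed. *)
Lemma koszul_cat s1 s2 t1 t2 : uniq (s1 ++ s2) -> perm_eq s1 t1 -> perm_eq s2 t2 ->
  koszul predT (s1 ++ s2) (t1 ++ t2) = (koszul predT s1 t1 + koszul predT s2 t2)%N.
Proof.
rewrite cat_uniq => /and3P[_ /hasPn disj _] st1 st2.
have in2 x : x \in s2 -> (x \in s1 = false) * (x \in t1 = false).
  by move=> /disj /negbTE xs; rewrite -(perm_mem st1) xs.
have in1 x : x \in s1 -> (x \in s1 = true) * (x \in t1 = true).
  by move=> xs; rewrite -(perm_mem st1) xs.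
rewrite /koszul big_cat; congr (_ + _)%N; apply: eq_big_seq => x xs;
  rewrite big_cat /=.
- rewrite [X in (_ + X)%N]big1_seq ?addn0 => [|y /andP[_ ys]].
    by apply: eq_big_seq => y ys; rewrite !index_cat !(in1 _ xs) !(in1 _ ys).
  rewrite !index_cat !(in1 _ xs) !(in2 _ ys).
  rewrite [X in _ && X]ltnNge.
  have xt : (index x t1 < size t1)%N by rewrite index_mem -(perm_mem st1).
  by rewrite (leq_trans (ltnW xt)) ?leq_addr ?andbF.
- rewrite [X in (X + _)%N]big1_seq ?add0n => [|y /andP[_ ys]].
    by apply: eq_big_seq => y ys; rewrite !index_cat !(in2 _ xs) !(in2 _ ys) !ltn_add2l.
  rewrite !index_cat !(in2 _ xs) !(in1 _ ys) ltnNge.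
  have yt : (index y s1 < size s1)%N by rewrite index_mem.
  by rewrite (leq_trans (ltnW yt)) ?leq_addr.
Qed.

(** The reversed pairs are exactly those with one letter in each block. *)
Lemma koszul_swap s t : uniq (s ++ t) ->
  koszul predT (s ++ t) (t ++ s) = (size s * size t)%N.
Proof.
rewrite cat_uniq => /and3P[_ /hasPn disj _].
have int x : x \in t -> (x \in s = false) * (x \in t = true).
  by move=> xt; rewrite xt (negbTE (disj _ xt)).
have ins x : x \in s -> (x \in s = true) * (x \in t = false).
  by move=> xs; rewrite xs; split=> //; apply: contraTF xs => /disj.
have lts x y : x \in s -> (index x s < size s + y)%N.
  by rewrite -index_mem => /leq_trans -> //; apply: leq_addr.
have ltt x y : x \in t -> (index x t < size t + y)%N.
  by rewrite -index_mem => /leq_trans -> //; apply: leq_addr.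
rewrite /koszul big_cat /= [X in (_ + X)%N]big1_seq ?addn0 => [|x /andP[_ xt]].
  transitivity (\sum_(x <- s) size t)%N; last first.
    by rewrite big_const_seq count_predT iter_addn_0 mulnC.
  apply: eq_big_seq => x xs; rewrite big_cat /= big1_seq ?add0n => [|y /andP[_ ys]].
    rewrite -sum1_size; apply: eq_big_seq => y yt.
    rewrite !index_cat !(int _ yt) !(ins _ xs) lts //.
    by rewrite (leq_trans _ (leq_addr _ _)) // index_mem.
  rewrite !index_cat !(ins _ xs) !(ins _ ys) ltn_add2l.
  by case: ltngtP.
rewrite big1_seq // => y /andP[_]; rewrite mem_cat !index_cat !(int _ xt) => /orP[ys|yt].
  by rewrite !(ins _ ys) ltnNge ltnW ?lts.
by rewrite !(int _ yt) ltn_add2l; case: ltngtP.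
Qed.

End Koszul.

(** * Edge tensors, vertex tensors and the state sum of [xi_algebra] *)

Lemma fconnect_eta (G : ribbon_graph) (f h : flag G) :
  fconnect (eta G) f h = (h \in [:: f; eta G f]).
Proof.
apply: fconnect_cycle; last by rewrite inE eqxx.
by rewrite /= eta_inv !eqxx.
Qed.

Section XiStateSum.

#[local] Arguments edge_coef : simpl never.

Variable k : fieldType.
Let A := xi_algebra k.

(** Linearity has to be supplied at two levels, for each functional g(a, -) and for a |-> g(a, -),
    before [linfun] can be evaluated. *)
Lemma xi_mapPE (a b : xi_alg k) : (Defs.mapP A a : 'Hom(_, k^o)) b = xi_form a b.
Proof.
have linF (u : xi_alg k) : scalar (xi_form u) by exact: xi_form_linr.
pose F u : {linear xi_alg k -> k^o} :=
  HB.pack (xi_form u : xi_alg k -> k^o) (GRing.isLinear.Build _ _ _ _ _ (linF u)).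
have FE u : linfun (xi_form u : xi_alg k -> k^o) =1 xi_form u by exact: (lfunE (F u)).
have linL : linear (fun a : xi_alg k => linfun (xi_form a : xi_alg k -> k^o)).
  move=> c u v; apply/lfunP => w.
  by rewrite add_lfunE scale_lfunE !FE xi_form_linl.
pose L : {linear xi_alg k -> 'Hom(xi_alg k, k^o)} :=
  HB.pack (fun a : xi_alg k => linfun (xi_form a : xi_alg k -> k^o))
    (GRing.isLinear.Build _ _ _ _ _ linL).
by rewrite -FE; congr (fun_of_lfun _ b); exact: (lfunE L).
Qed.

(** Nondegeneracy of the form makes [mapP] injective, so its formal inverse is a true left
    inverse. *)
Lemma xi_mapP_inv (a : xi_alg k) : (Defs.mapP A)^-1%VF (Defs.mapP A a) = a.
Proof.
apply: lker0_lfunK; apply/lker0P => u v uv; apply/eqP; rewrite -subr_eq0; apply/eqP.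
apply: xi_form_nondeg => b.
by rewrite -xi_mapPE linearB /= uv subrr lfunE.
Qed.

(** The functionals dual to 1 and xi are g(xi, -) and g(1, -). [It_dual] kills the first and sends
    the second to - g(xi, -), so only the pair (xi, xi) survives, with value - g(xi, 1) = -1. *)
Lemma xi_edge_coef (i j : 'I_2) : edge_coef (A := A) i j = - (xi_par i && xi_par j)%:R.
Proof.
have dvecE (l : 'I_2) b : dvec (A := A) l b = xi_coef l b.
  by rewrite /dvec lfunE -[RHS]coord_coef.
have dE (l : 'I_2) : dvec (A := A) l = Defs.mapP A (if xi_par l then 1 else xi k).
  apply/lfunP => b; rewrite dvecE xi_mapPE /xi_form.
  by case: l => [[|[|//]] ilt] /=;
    rewrite !(xi_coef1, xi_coefX) /= !mul1r !mul0r ?addr0 ?add0r.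
have ItE : It_dual (A := A) (xi_par i) (dvec (A := A) i) =
    Defs.mapP A (- (xi_par i)%:R *: xi k).
  apply/lfunP => b; rewrite /It_dual scale_lfunE comp_lfunE dvecE.
  rewrite (_ : homotopy_It A b = xi_coef 0 b *: xi k); last exact: xi_ItE.
  rewrite xi_coefZ xi_coefX xi_mapPE /xi_form !xi_coefZ !xi_coefX.
  by case: i => [[|[|//]] ilt] /=; rewrite /GRing.scale /=; ring.
rewrite /edge_coef /ginv [par _]/(xi_par i) ItE dE !xi_mapP_inv /=.
rewrite /xi_form !xi_coefZ !xi_coefX.
by case: (xi_par i); case: (xi_par j); rewrite !(xi_coef1, xi_coefX) /=; ring.
Qed.

Definition xi_weight (n : nat) : k := (-1) ^+ 'C(n, 2) * (odd n)%:R.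

(** The label [ord_max] is that of xi. As all arguments are odd, the sign exponent is 1 + ... + (n -
    1) = C(n, 2). Since xi^2 = 1, the power xi^(n - 1) is 1 for n odd and xi for n even, and g(1,
    xi) = 1 while g(xi, xi) = 0. *)
Lemma xi_alpha n (x : nat -> 'I_2) : (0 < n)%N -> (forall i, x i = ord_max) ->
  alpha (A := A) n x = xi_weight n.
Proof.
move=> n_gt0 xE; have bE i : bvec (A := A) (x i) = xi k by rewrite xE.
rewrite /alpha /xi_weight; congr (_ ^+ _ * _).
  rewrite -bin2_sum -(prednK n_gt0) [RHS]big_nat_recl // add0n big_add1.
  apply: eq_bigr => i _; rewrite -[RHS]subn0 -[RHS]muln1 -sum_nat_const_nat.
  by apply: eq_bigr => j _; rewrite xE.
under eq_bigr do rewrite bE.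
rewrite bE prodr_const_nat subn0.
have xi_even m : xi k ^+ m.*2 = 1.
  by elim: m => // m IH; rewrite doubleS !exprS mulrA xi_sqr mul1r.
case: n n_gt0 => // n _ /=; rewrite -(odd_double_half n) exprD xi_even mulr1.
rewrite oddD odd_double addbF oddb.
by case: (odd n); rewrite /= /xi_form ?expr1 ?expr0 !(xi_coef1, xi_coefX) /=; ring.
Qed.

Variable G : ribbon_graph.

(* No Koszul sign appears because pi xi is even. *)
Lemma xi_state_sum (r : seq (flag G)) : state_sum A r =
  (-1) ^+ size (edge_flags G) * \prod_(f <- r) xi_weight (valence f).
Proof.
rewrite /state_sum (bigD1 [ffun=> ord_max]) //= [X in _ + X]big1 ?addr0 => [|x xN]; last first.
  have [f xf] : exists f, ~~ xi_par (x f).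
    apply/existsP; rewrite -negb_forall; apply: contra xN => /forallP xE.
    apply/eqP/ffunP => f; rewrite ffunE; apply: val_inj => /=.
    exact/eqP/xE.
  suff -> : \prod_(h <- edge_flags G) edge_coef (A := A) (x h) (x (eta G h)) = 0.
    by rewrite mulr0.
  (* The edge through [f] is listed under its root, which is [f] or [eta G f]; the label 1 at [f]
     kills its coefficient in both cases. *)
  apply/eqP; rewrite prodf_seq_eq0; apply/hasP; exists (froot (eta G) f).
    by rewrite mem_enum; apply: roots_root; apply: fconnect_sym; apply: perm_inj.
  rewrite /= xi_edge_coef oppr_eq0.
  have : fconnect (eta G) f (froot (eta G) f) by exact: connect_root.
  rewrite fconnect_eta !inE => /orP[]/eqP ->; last rewrite eta_inv.
    by rewrite (negPf xf).
  by rewrite (negPf xf) andbF.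
set x : {ffun flag G -> 'I_2} := [ffun=> ord_max].
have xE f : x f = ord_max by rewrite ffunE.
have even_x f : odd_label (A := A) x f = false by rewrite /odd_label xE.
rewrite /koszul big1 ?expr0 ?mul1r => [|f _]; last first.
  by rewrite big1 // => h _; rewrite even_x.
rewrite mulrC; congr (_ * _).
  under eq_bigr do rewrite xi_edge_coef !xE /=.
  by rewrite big_const_seq count_predT iter_mulr_1.
elim: r => [|f r IH] /=; first by rewrite big_nil.
rewrite big_cons IH big1 ?mul0n ?expr0 ?mul1r => [|h _]; last by rewrite even_x.
by rewrite xi_alpha // lt0n card_porbit_neq0.
Qed.

End XiStateSum.

(** * Cycles of a permutation and systems of representatives *)

Section Cycles.

Variables (T : finType) (s : {perm T}).
Implicit Types (x y : T) (p r : seq T).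

Lemma porbit_fconnect x y : (y \in porbit s x) = fconnect s x y.
Proof.
apply/porbitP/idP => [[i ->]|/iter_findex <-]; first by rewrite permX fconnect_iter.
by exists (findex s x y); rewrite permX.
Qed.

(** An explicit cycle without repetition fixes the size of the orbit, so orbits of concrete
    permutations can be read off from a list. *)
Lemma traject_fcycle x p : fcycle s (x :: p) -> uniq (x :: p) ->
  traject s x #|porbit s x| = x :: p.
Proof.
move=> sp up; have -> : #|porbit s x| = (size p).+1.
  rewrite -[RHS](order_cycle sp up (mem_head x p)); apply: eq_card => y.
  by rewrite porbit_fconnect.
move: sp; rewrite /= rcons_path => /andP[/fpathP[n pE] _].
by rewrite [in LHS]pE size_traject -pE.
Qed.

(** Absence of repetition makes the orbits of the representatives pairwise distinct, and
    exhaustiveness makes every orbit occur. *)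
Lemma porbit_reps r : uniq (flatten [seq traject s x #|porbit s x| | x <- r]) ->
    (forall y, y \in flatten [seq traject s x #|porbit s x| | x <- r]) ->
  perm_eq [seq porbit s x | x <- r] (enum (porbits s)).
Proof.
move=> ur fr; apply: uniq_perm (enum_uniq _) _.
  elim: r ur {fr} => //= x r IH; rewrite cat_uniq => /and3P[_ /hasPn xr /IH ->].
  rewrite andbT; apply/mapP => -[y yr xy].
  have := xr y; rewrite -porbit_traject xy porbit_id => /implyP; rewrite implybF.
  by case/flatten_mapP; exists y => //; rewrite -porbit_traject porbit_id.
move=> v; rewrite mem_enum; apply/mapP/imsetP => [[x _ ->]|[x _ ->]]; first by exists x.
have /flatten_mapP[y yr xy] := fr x; exists y => //.
by apply/eqP; rewrite eq_porbit_mem porbit_traject.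
Qed.

Lemma card_porbits r : uniq (flatten [seq traject s x #|porbit s x| | x <- r]) ->
    (forall y, y \in flatten [seq traject s x #|porbit s x| | x <- r]) ->
  #|porbits s| = size r.
Proof. by move=> ur fr; rewrite cardE -(perm_size (porbit_reps ur fr)) size_map. Qed.

(** Relates the roots, on which [Zgraph] is built, to the orbits, which are the vertices. *)
Lemma porbit_froots : perm_eq [seq porbit s x | x <- enum (froots s)] (enum (porbits s)).
Proof.
have sym : connect_sym (frel s) by apply: fconnect_sym; apply: perm_inj.
apply: uniq_perm (enum_uniq _) _.
  rewrite map_inj_in_uniq ?enum_uniq // => x y; rewrite !mem_enum => /eqP xr /eqP yr.
  move=> xy; rewrite -xr -yr; apply/(fingraph.rootP sym).
  by rewrite -porbit_fconnect xy porbit_id.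
move=> v; rewrite mem_enum; apply/mapP/imsetP => [[x _ ->]|[x _ ->]]; first by exists x.
exists (froot s x); first by rewrite mem_enum; apply: roots_root.
by apply/eqP; rewrite eq_sym eq_porbit_mem porbit_fconnect connect_root.
Qed.


End Cycles.

(** * Even rearrangements *)

Section EvenShuffle.

Variable T : eqType.
Implicit Types s t u : seq T.

(** Duplicate-free words in this relation give the same wedge monomial. *)
Definition even_shuffle s t := perm_eq s t && ~~ odd (koszul predT s t).

Lemma even_shuffle_refl s : even_shuffle s s.
Proof. by rewrite /even_shuffle perm_refl koszul_refl. Qed.

Lemma even_shuffle_trans s t u : even_shuffle s t -> even_shuffle t u -> even_shuffle s u.
Proof.
case/andP=> st est /andP[tu etu]; have su := perm_trans st tu.
by rewrite /even_shuffle su (odd_koszul_trans st su) (negPf est) (negPf etu).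
Qed.

Lemma even_shuffle_cat s1 s2 t1 t2 : uniq (s1 ++ s2) ->
  even_shuffle s1 t1 -> even_shuffle s2 t2 -> even_shuffle (s1 ++ s2) (t1 ++ t2).
Proof.
move=> us /andP[p1 e1] /andP[p2 e2].
by rewrite /even_shuffle perm_cat // koszul_cat // oddD (negPf e1) (negPf e2).
Qed.

Lemma even_shuffle_swap s t : uniq (s ++ t) -> ~~ odd (size s * size t) ->
  even_shuffle (s ++ t) (t ++ s).
Proof. by move=> us est; rewrite /even_shuffle perm_catC perm_refl koszul_swap. Qed.

Lemma odd_koszul_shuffle s t u : perm_eq s t -> even_shuffle t u ->
  odd (koszul predT s u) = odd (koszul predT s t).
Proof.
move=> st /andP[tu etu].
by rewrite (odd_koszul_trans st (perm_trans st tu)) (negPf etu) addbF.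
Qed.

End EvenShuffle.

(** * Independence of the vertex word from flag and vertex choices at odd valences *)

Section VertexWords.

Variable G : ribbon_graph.
Implicit Types (f h : flag G) (r : seq (flag G)).

Definition vertex_block f : seq (cell G) :=
  inr (vertex f) :: [seq inl h | h <- vertex_flags f].

Lemma mem_vertex_flags f h : (h \in vertex_flags f) = (h \in vertex f).
Proof. by rewrite -porbit_traject. Qed.

Lemma mem_vertex_block f (c : cell G) : (c \in vertex_block f) =
  match c with inl h => h \in vertex f | inr v => v == vertex f end.
Proof.
rewrite inE; case: c => [h|v] /=; last by rewrite orbC; case: mapP => // -[].
by rewrite -mem_vertex_flags mem_map // => ? ? [].
Qed.

Lemma vertex_block_inj f h (c : cell G) :
  c \in vertex_block f -> c \in vertex_block h -> vertex f = vertex h.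
Proof.
rewrite !mem_vertex_block; case: c => [x|v]; last by move=> /eqP <- /eqP.
by rewrite -!eq_porbit_mem => /eqP xf /eqP xh; rewrite /vertex -xf.
Qed.

Lemma uniq_vertex_block f : uniq (vertex_block f).
Proof.
rewrite /= map_inj_uniq ?uniq_traject_porbit ?andbT => [|? ? []//].
by apply/mapP => -[].
Qed.

Lemma uniq_vertex_word r : uniq [seq vertex f | f <- r] -> uniq (vertex_word r).
Proof.
elim: r => // f r IH; rewrite map_cons cons_uniq => /andP[fr /IH ur].
rewrite -[vertex_word _]/(vertex_block f ++ vertex_word r) cat_uniq uniq_vertex_block ur andbT.
apply/hasPn => c /flatten_mapP[h hr ch]; apply: contra fr => cf.
by rewrite (vertex_block_inj cf ch) map_f.
Qed.

Lemma vertex_word_cells r : perm_eq [seq vertex f | f <- r] (enum (vertices G)) ->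
  perm_eq (vertex_word r) (cells G).
Proof.
move=> rE; apply: uniq_perm (uniq_cells _) _.
  by rewrite uniq_vertex_word // (perm_uniq rE) enum_uniq.
have fr h : vertex h \in [seq vertex f | f <- r].
  by rewrite (perm_mem rE) mem_enum; apply: imset_f.
move=> c; rewrite mem_cells; apply/flatten_mapP/idP => [[f _]|].
  rewrite -/(vertex_block f) mem_vertex_block; case: c => // v /eqP ->.
  exact: imset_f.
case: c => [h _|v /imsetP[h _ ->]]; have /mapP[f fr' hf] := fr h; exists f => //.
  by rewrite -/(vertex_block f) mem_vertex_block -hf porbit_id.
by rewrite -/(vertex_block f) mem_vertex_block -hf.
Qed.

(** Changing the initial flag of an n-valent vertex swaps adjacent words of lengths i and n - i, and
    i (n - i) is even for n odd. *)
Lemma vertex_block_shuffle f h : vertex f = vertex h -> odd (valence f) ->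
  even_shuffle (vertex_block f) (vertex_block h).
Proof.
move=> fh ov; have : h \in vertex f by rewrite fh porbit_id.
rewrite -mem_vertex_flags => /trajectP[i lti hE].
have vE : valence h = (valence f - i + i)%N by rewrite subnK ?(ltnW lti) // /valence -fh.
have uf := uniq_traject_porbit (sigma G) f.
have fE : vertex_flags f = traject (sigma G) f i ++ traject (sigma G) h (valence f - i).
  by rewrite hE -trajectD subnKC // ltnW.
have hE' : vertex_flags h = traject (sigma G) h (valence f - i) ++ traject (sigma G) f i.
  rewrite /vertex_flags vE trajectD; congr (_ ++ traject _ _ _).
  by rewrite hE -iterD subnK ?iter_porbit // ltnW.
rewrite /vertex_block -cat1s -(cat1s (inr (vertex h))) fh.
apply: even_shuffle_cat; last 2 first.
- exact: even_shuffle_refl.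
- rewrite fE hE' !map_cat; apply: even_shuffle_swap.
    rewrite -map_cat -fE map_inj_uniq // => ? ? [] //.
  rewrite !size_map !size_traject oddM oddB ?(ltnW lti) // ov.
  by case: (odd i).
by rewrite -fh; apply: (uniq_vertex_block f).
Qed.

(* A block has one letter more than its vertex has flags, hence evenly many. *)
Lemma vertex_word_shuffle r r' : uniq [seq vertex f | f <- r] ->
    perm_eq [seq vertex f | f <- r] [seq vertex f | f <- r'] ->
    {in r, forall f, odd (valence f)} ->
  even_shuffle (vertex_word r) (vertex_word r').
Proof.
elim: r r' => [|f r IH] r' ur rr' ov.
  move/perm_size: rr'; rewrite !size_map => /esym/size0nil ->.
  exact: even_shuffle_refl.
have : vertex f \in [seq vertex f | f <- r'] by rewrite -(perm_mem rr') mem_head.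
case/mapP => h hr fh; case/splitPr: hr rr' => p q rr'.
have bE t u : vertex_word (t ++ u) = vertex_word t ++ vertex_word u.
  by rewrite /vertex_word map_cat flatten_cat.
have cE g t : vertex_word (g :: t) = vertex_block g ++ vertex_word t by [].
have rpq : perm_eq [seq vertex f | f <- r] [seq vertex f | f <- p ++ q].
  rewrite -(perm_cons (vertex f)); apply: (perm_trans rr').
  by rewrite !map_cat /= -fh perm_sym -cat1s perm_catCA perm_refl.
have upq : uniq [seq vertex f | f <- h :: p ++ q].
  by rewrite /= -fh -(perm_uniq rpq) -(perm_mem rpq); exact: ur.
(* First the leading block is rotated to start at [h] and the tail is reordered by induction; then
   the leading block, of even length, moves past the word of [p]. *)
apply: (@even_shuffle_trans _ _ (vertex_word (h :: p ++ q))).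
  rewrite !cE; apply: even_shuffle_cat; first exact: (uniq_vertex_word ur).
    by apply: vertex_block_shuffle fh _; apply: ov; rewrite mem_head.
  apply: IH rpq _; first by case/andP: ur.
  by move=> g gr; apply: ov; rewrite inE gr orbT.
rewrite cE !bE cE catA [X in even_shuffle _ X]catA.
have ub := uniq_vertex_word upq; rewrite cE bE catA cat_uniq in ub.
apply: even_shuffle_cat; last exact: even_shuffle_refl.
  by rewrite cat_uniq.
apply: even_shuffle_swap; first by case/andP: ub.
rewrite /= size_map size_traject /= -[valence h](congr1 (fun A : {set _} => #|A|) fh).
by rewrite oddM /= (ov f) ?mem_head.
Qed.

End VertexWords.

(** * The partition function of [xi_algebra] as a sign times vertex weights *)

Section XiZgraph.

Variables (k : fieldType) (G : ribbon_graph).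
Implicit Types (o : orientation G) (r : seq (flag G)).

(** With all valences odd, passing from the roots of [sigma] to other representatives in any order
    is an even shuffle, so a convenient [r] may be used. The weights depend only on the sizes of the
    vertices. *)
Lemma xi_Zgraph o r : perm_eq [seq vertex f | f <- r] (enum (vertices G)) ->
    {in r, forall f, odd (valence f)} ->
  Zgraph (xi_algebra k) o =
    (-1) ^+ (osign o + koszul predT (oword o) (vertex_word r)) *
    ((-1) ^+ size (edge_flags G) * \prod_(f <- r) xi_weight k (valence f)).
Proof.
move=> rE ov; rewrite /Zgraph xi_state_sum.
have fr : perm_eq [seq vertex f | f <- r] [seq vertex f | f <- enum (froots (sigma G))].
  by rewrite (perm_trans rE) // perm_sym; apply: porbit_froots.
congr (_ * (_ * _)).
  rewrite -signr_odd -[RHS]signr_odd !oddD; congr ((-1) ^+ nat_of_bool (_ (+) _)).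
  apply: odd_koszul_shuffle; last first.
    by apply: vertex_word_shuffle fr ov; rewrite (perm_uniq rE) enum_uniq.
  by rewrite (perm_trans (oword_cells o)) // perm_sym; apply: vertex_word_cells.
have wE r' : \prod_(f <- r') xi_weight k (valence f) =
    \prod_(v <- [seq vertex f | f <- r']) xi_weight k #|v| by rewrite big_map.
by rewrite !wE; apply: perm_big; rewrite perm_sym.
Qed.

Lemma xi_Zgraph_even o (f : flag G) : ~~ odd (valence f) -> Zgraph (xi_algebra k) o = 0.
Proof.
move=> ev; rewrite /Zgraph xi_state_sum.
suff -> : \prod_(f <- enum (froots (sigma G))) xi_weight k (valence f) = 0 by rewrite !mulr0.
have : vertex f \in [seq vertex f | f <- enum (froots (sigma G))].
  by rewrite (perm_mem (porbit_froots _)) mem_enum; apply: imset_f.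
case/mapP => h hr fh; apply/eqP; rewrite prodf_seq_eq0; apply/hasP; exists h => //.
by rewrite /= /xi_weight /valence -fh (negPf ev) mulr0.
Qed.

End XiZgraph.

(** * Orientation signs and vertices after contracting an edge *)

Section Contraction.

Variables (G : ribbon_graph) (f : flag G).
Hypothesis nloop : vertex f != vertex (eta G f).

Local Notation H := (contract nloop).

(** Carries cells of the contracted graph back to [G], where signs can be compared; a vertex away
    from the edge returns to the original one. *)
Definition pull (c : cell H) : cell G :=
  match c with inl x => inl (val x) | inr v => inr [set val y | y in v] end.

Lemma pull_inj : injective pull.
Proof.
move=> [x|v] [y|w] //= []; first by move/val_inj => ->.
by move/(imset_inj val_inj) => ->.
Qed.

(** The remaining vertices contain neither contracted flag, so restricting them to the remaining
    flags loses nothing. *)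
Lemma pull_push (o : orientation G) :
  map pull (pmap (push nloop) (other_cells f o)) = other_cells f o.
Proof.
have pK c : c \in other_cells f o -> omap pull (push nloop c) = Some c.
  move=> co; have := mem_other co.
  have : c \notin contracted_cells f by move: co; rewrite mem_filter => /andP[].
  case: c {co} => [x|v] /=.
    rewrite !inE /= => xf _; rewrite insubT //=.
    by rewrite !inE negb_or; apply/andP; split;
      apply: contra xf => /eqP ->; rewrite eqxx ?orbT.
  move=> _ [x vE mx]; congr (Some (inr _)); apply/setP => y.
  apply/imsetP/idP => [[z]|yv]; first by rewrite inE => zv ->.
  have yP : y \notin [:: f; eta G f].
    have vy : vertex y = vertex (val x) by apply/eqP; rewrite eq_porbit_mem -[porbit _ _]vE.
    apply: contra mx; rewrite /merged -vy !inE => /orP[]/eqP ->; by rewrite eqxx ?orbT.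
  by exists (Sub y yP : cflag f); rewrite ?inE.
elim: (other_cells f o) pK => //= c s IH pK.
have := pK c (mem_head _ _); case: (push nloop c) => [c'|] //= -[->].
by rewrite IH // => d ds; apply: pK; rewrite inE ds orbT.
Qed.

(** Passing through [other_cells f o] splits both sides into the sign built into the induced
    orientation and the sign of reordering the remaining cells; a common prefix does not affect the
    latter. Signs on the contracted graph thus become signs on [G]. *)
Lemma odd_induced_orientation (o : orientation G) (w : seq (cell H)) :
    perm_eq (inr (new_vertex nloop) :: w) (cells H) ->
  let o' := induced_orientation nloop o in
  odd (osign o' + koszul predT (oword o') (inr (new_vertex nloop) :: w)) =
  odd (osign o + koszul predT (oword o) (contracted_cells f ++ map pull w)).
Proof.
move=> wE o'; pose v : cell H := inr (new_vertex nloop).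
have ow : perm_eq (oword o) (contracted_cells f ++ other_cells f o).
  rewrite -(perm_filterC (mem (contracted_cells f))) perm_cat2r.
  apply: uniq_perm; first by rewrite filter_uniq // (perm_uniq (oword_cells o)) uniq_cells.
    rewrite /= !inE /= !andbT negb_or andbT; apply/andP; split.
      by apply: contraNneq nloop => -[->].
    by apply: contraNneq (eta_free f) => -[<-].
  move=> c; rewrite mem_filter (perm_mem (oword_cells o)) mem_cells /=.
  apply: andb_idr; case: c => // u; rewrite !inE => /or4P[]// /eqP[->];
    exact: imset_f.
have pw : perm_eq (pmap (push nloop) (other_cells f o)) w.
  by rewrite -(perm_cons v) (perm_trans (induced_word_cells nloop o)) // perm_sym.
have pw' : perm_eq (other_cells f o) (map pull w) by rewrite -(pull_push o) perm_map.
have uo := uniq_cells G; rewrite -(perm_uniq (oword_cells o)) (perm_uniq ow) in uo.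
have ui := uniq_cells H; rewrite -(perm_uniq (induced_word_cells nloop o)) in ui.
rewrite /o' /= /induced_word -!/v -[v :: pmap _ _]cat1s -(cat1s v w).
rewrite koszul_cat // koszul_refl add0n.
rewrite -(koszul_map _ _ pull_inj) pull_push !oddD oddb.
have ow' : perm_eq (oword o) (contracted_cells f ++ map pull w).
  by rewrite (perm_trans ow) // perm_cat2l.
by rewrite [in RHS](odd_koszul_trans ow ow') koszul_cat // koszul_refl add0n oddb !addbA.
Qed.

(** A cycle of [csigma_val] written in flags of [G] lifts to the remaining flags by iterating
    [csigma], so contracted vertices can be read off inside [G]. *)
Lemma contract_vertex_flags (x : flag H) (p : seq (flag G)) :
    fcycle (csigma_val f) (val x :: p) -> uniq (val x :: p) ->
  [seq val y | y <- vertex_flags x] = val x :: p.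
Proof.
move=> cp up.
have [q qE] : exists q : seq (flag H), [seq val y | y <- x :: q] = val x :: p.
  exists (traject (csigma nloop) (csigma nloop x) (size p)).
  rewrite -[x :: _]/(traject (csigma nloop) x (size p).+1).
  move: cp; rewrite /= rcons_path => /andP[/fpathP[n ->] _]; rewrite size_traject.
  congr (_ :: _); rewrite -val_csigma; elim: n (csigma nloop x) => //= n IH y.
  by rewrite IH val_csigma.
have cq : fcycle (csigma nloop) (x :: q).
  rewrite -qE cycle_map in cp; apply: sub_cycle cp => y z /=.
  by rewrite -val_csigma (inj_eq val_inj).
rewrite -qE; congr map; apply: traject_fcycle => //.
by move: up; rewrite -qE; apply: map_uniq.
Qed.

End Contraction.

Lemma size_edge_flags (G : ribbon_graph) : (size (edge_flags G) * 2 = #|flag G|)%N.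
Proof.
transitivity (fcard (eta G) predT * 2)%N.
  by rewrite -cardE; congr (_ * _)%N; apply: eq_card => f; rewrite !inE andbT.
rewrite (fcard_order_set (@perm_inj _ (eta G))) //.
apply/subsetP => f _; rewrite inE; apply/eqP.
rewrite (order_cycle (p := [:: f; eta G f])) ?mem_head //.
  by rewrite /= eta_inv !eqxx.
by rewrite /= inE eq_sym eta_free.
Qed.

Lemma pull_unmerged (G : ribbon_graph) (f : flag G) (nloop : vertex f != vertex (eta G f))
    (x : flag (contract nloop)) :
  ~~ merged f (val x) -> pull (inr (vertex x)) = inr (vertex (val x)).
Proof.
move=> mx; congr inr; apply/setP => y; apply/imsetP/idP => [[z]|yx].
  by rewrite unmerged_porbitE // => zx ->.
have yP : y \notin [:: f; eta G f].
  have vy : vertex y = vertex (val x) by apply/eqP; rewrite eq_porbit_mem.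
  by apply: contra mx; rewrite /merged -vy !inE => /orP[]/eqP ->; rewrite eqxx ?orbT.
by exists (Sub y yP : cflag f); rewrite ?unmerged_porbitE.
Qed.

(** The contracted graph has vertices of valence 5 and 3 and four edges. The edges give (-1)^4, the
    weights (-1)^C(5, 2) = 1 and (-1)^C(3, 2) = -1; this is the minus sign of the result. *)
Lemma contract_xi_Zgraph (k : fieldType) (G : ribbon_graph) (f g : flag G)
    (nloop : vertex f != vertex (eta G f)) (p q : seq (flag G)) (o : orientation G) :
  fcycle (csigma_val f) (sigma G f :: p) -> fcycle (csigma_val f) (g :: q) ->
  uniq [:: f, eta G f & (sigma G f :: p) ++ g :: q] ->
  (forall h, h \in [:: f, eta G f & (sigma G f :: p) ++ g :: q]) ->
  ~~ merged f g -> size p = 4 -> size q = 2 ->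
  Zgraph (xi_algebra k) (induced_orientation nloop o) =
  - (-1) ^+ (osign o + koszul predT (oword o)
      (contracted_cells f ++ map inl (sigma G f :: p) ++
       inr (vertex g) :: map inl (g :: q))).
Proof.
move=> cp cq u full mg sp sq.
have [u1 u2] : uniq (sigma G f :: p) /\ uniq (g :: q).
  have : uniq ([:: f; eta G f] ++ ((sigma G f :: p) ++ g :: q)) by [].
  by rewrite cat_uniq => /and3P[_ _]; rewrite cat_uniq => /and3P[].
have gP : g \notin [:: f; eta G f].
  by apply: contra mg; rewrite !inE /merged => /orP[]/eqP ->; rewrite eqxx ?orbT.
pose x : flag (contract nloop) := first_flag nloop.
pose y : flag (contract nloop) := Sub g gP.
have xE : [seq val z | z <- vertex_flags x] = sigma G f :: p by exact: contract_vertex_flags.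
have yE : [seq val z | z <- vertex_flags y] = g :: q by exact: contract_vertex_flags.
have vx : valence x = 5.
  by rewrite -[LHS](size_traject (csigma nloop) x) -(size_map val) xE /= sp.
have vy : valence y = 3.
  by rewrite -[LHS](size_traject (csigma nloop) y) -(size_map val) yE /= sq.
pose fl := flatten [seq vertex_flags z | z <- [:: x; y]].
have flE : map val fl = (sigma G f :: p) ++ g :: q by rewrite /fl /= cats0 map_cat xE yE.
have ufl : uniq fl.
  by rewrite -(map_inj_uniq val_inj) flE; case/and3P: u.
have fullfl z : z \in fl.
  rewrite -(mem_map val_inj) flE; have /andP[/negPf zf /negPf zf'] := cflagP z.
  by have := full (val z); rewrite inE zf inE zf'.
have rE : perm_eq [seq vertex z | z <- [:: x; y]] (enum (vertices (contract nloop))).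
  exact: porbit_reps.
rewrite (xi_Zgraph _ _ rE) => [|z]; last by rewrite !inE => /orP[]/eqP ->; rewrite ?vx ?vy.
have -> : size (edge_flags (contract nloop)) = 4.
  apply/eqP; rewrite -(eqn_pmul2r (isT : 0 < 2)%N) size_edge_flags.
  rewrite (_ : #|flag _| = size fl); last first.
    by rewrite -(card_uniqP ufl); apply: eq_card => z; rewrite fullfl.
  by rewrite -(size_map val) flE size_cat /= sp sq.
(* Since [x] is [first_flag], the word begins with [new_vertex], the form that
   [odd_induced_orientation] expects. *)
have wE : vertex_word [:: x; y] =
    inr (new_vertex nloop) :: [seq inl z | z <- vertex_flags x] ++ vertex_block y.
  by rewrite /vertex_word /= cats0.
rewrite -signr_odd wE odd_induced_orientation -?wE ?vertex_word_cells // signr_odd.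
have vyE : map (@pull _ _ nloop) (vertex_block y) =
    inr (vertex g) :: [seq pull (inl z) | z <- vertex_flags y].
  by rewrite /vertex_block map_cons pull_unmerged // -map_comp.
rewrite map_cat vyE -map_comp.
have inlE (s : seq (flag (contract nloop))) :
  [seq pull (inl z) | z <- s] = [seq inl z | z <- [seq val z | z <- s]] by rewrite -map_comp.
rewrite -![map (_ \o _) _]/[seq pull (inl z) | z <- _] !inlE xE yE.
rewrite !big_cons big_nil vx vy /xi_weight /= -[RHS]mulrN1; congr (_ * _).
by rewrite (_ : 'C(5, 2) = 10)%N // (_ : 'C(3, 2) = 3)%N //; ring.
Qed.

(** * The graph with vertices a, b, t and its contractions *)

Section Abt.

Local Notation G := abt_graph.

Lemma abt_trajectE : (traject abt_sigma a1 #|porbit abt_sigma a1| = [:: a1; a2; a3]) *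
  (traject abt_sigma b1 #|porbit abt_sigma b1| = [:: b1; b2; b3]) *
  (traject abt_sigma t1 #|porbit abt_sigma t1| = [:: t1; t2; t3; t4]).
Proof. by do !split; apply: traject_fcycle; rewrite //= !abt_sigmaE. Qed.

Lemma card_abt_vertices : #|vertices G| = 3.
Proof.
apply: (card_porbits (r := [:: a1; b1; t1])); rewrite /= !abt_trajectE //.
by elim/ord10_ind.
Qed.

Lemma card_abt_edges : #|porbits abt_eta| = 5.
Proof.
have tE : (traject abt_eta a1 #|porbit abt_eta a1| = [:: a1; t1]) *
    (traject abt_eta a2 #|porbit abt_eta a2| = [:: a2; b2]) *
    (traject abt_eta a3 #|porbit abt_eta a3| = [:: a3; b3]) *
    (traject abt_eta b1 #|porbit abt_eta b1| = [:: b1; t3]) *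
    (traject abt_eta t2 #|porbit abt_eta t2| = [:: t2; t4]).
  by do !split; apply: traject_fcycle; rewrite //= !abt_etaE.
apply: (card_porbits (r := [:: a1; a2; a3; b1; t2])); rewrite /= !tE //.
by elim/ord10_ind.
Qed.

Lemma abt_punctures : punctures G = 2.
Proof.
have sE x : (abt_sigma * abt_eta)%g x = abt_eta (abt_sigma x) by exact: permM.
have tE : (traject (abt_sigma * abt_eta)%g a1 #|porbit (abt_sigma * abt_eta)%g a1| =
     [:: a1; b2; a3; t1; t4]) *
    (traject (abt_sigma * abt_eta)%g a2 #|porbit (abt_sigma * abt_eta)%g a2| =
     [:: a2; b3; t3; t2; b1]).
  by do !split; apply: traject_fcycle; rewrite //= !sE !(abt_sigmaE, abt_etaE).
apply: (card_porbits (r := [:: a1; a2])); rewrite /= !tE //.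
by elim/ord10_ind.
Qed.

(** The Euler characteristic is 3 - 5 + 2 = 0 = 2 - 2 g. *)
Lemma abt_genus : has_genus G 1.
Proof. by rewrite /has_genus card_abt_vertices abt_punctures card_abt_edges. Qed.

Lemma abt_vertex_neq : (vertex (a1 : flag G) != vertex (b1 : flag G)) *
  (vertex (a1 : flag G) != vertex (t1 : flag G)) *
  (vertex (b1 : flag G) != vertex (t1 : flag G)).
Proof. by rewrite !eq_porbit_mem !porbit_traject !abt_trajectE. Qed.

Lemma mem_abt_froots (f : flag G) :
  (f \in froots (eta G)) = (f \in [:: a1; a2; a3; b1; t2]).
Proof.
pose s10 := [:: a1; a2; a3; b1; b2; b3; t1; t2; t3; t4].
have enumE : enum 'I_10 = s10 by apply: (inj_map val_inj); rewrite val_enum_ord.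
have etaE h : abt_eta h = nth h [:: t1; b2; b3; t3; a2; a3; a1; t4; b1; t2] h.
  by elim/ord10_ind: h; rewrite abt_etaE.
(* A root is the first flag of its orbit in the enumeration of ['I_10], which turns membership into
   a computation on a list. *)
have rootE : (f \in froots abt_eta) =
    (head f [seq h <- s10 | h \in [:: f; abt_eta f]] == f).
  rewrite -enumE -[LHS]/(odflt f (ohead (enum (fconnect abt_eta f))) == f).
  rewrite [enum (fconnect _ _)]/enum_mem -enumT.
  rewrite (eq_filter (a2 := [in [:: f; abt_eta f]])) => [|h].
    by case: [seq _ <- _ | _].
  exact: (@fconnect_eta G).
by rewrite rootE etaE {rootE}; elim/ord10_ind: f.
Qed.

Lemma abt_vertexE : (vertex (t2 : flag G) = vertex (t1 : flag G)) *
  (vertex (t3 : flag G) = vertex (t1 : flag G)) *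
  (vertex (t4 : flag G) = vertex (t1 : flag G)).
Proof.
have vs := @vertex_sigma G; have := vs t3; have := vs t2; have := vs t1.
by rewrite /= !abt_sigmaE => -> -> ->.
Qed.

(** Contracting (a1 t1) merges a and t into (a2 a3 t2 t3 t4) and keeps b. The induced orientation
    sends this monomial to the vertex word of the quotient. In [abt_word2], the edge (b1 t3) gives
    (b2 b3 t4 t1 t2) and keeps a. *)
Definition abt_word1 : seq (cell G) :=
  contracted_cells (a1 : flag G) ++ map inl [:: a2; a3; t2; t3; t4] ++
  inr (vertex (b1 : flag G)) :: map inl [:: b1; b2; b3].

Definition abt_word2 : seq (cell G) :=
  contracted_cells (b1 : flag G) ++ map inl [:: b2; b3; t4; t1; t2] ++
  inr (vertex (a1 : flag G)) :: map inl [:: a1; a2; a3].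

(** The half-turn of the graph exchanges a with b, each a_i with b_i, t1 with t3 and t2 with t4. It
    carries the first word to the second and is a product of six transpositions, hence even. *)
Lemma abt_words (o : orientation G) :
  odd (koszul predT (oword o) abt_word1) = odd (koszul predT (oword o) abt_word2).
Proof.
(* The code of the cells is injective, so the sign can be computed on codes. *)
pose vs := [seq vertex f | f <- [:: (a1 : flag G); b1; t1]].
pose dec (c : 'I_10 + 'I_3) : cell G :=
  match c with inl f => inl f | inr i => inr (nth set0 vs i) end.
have decI : injective dec.
  have uvs : uniq vs by rewrite /= !inE negb_or !abt_vertex_neq.
  move=> [x|i] [y|j] //= []; first by move=> ->.
  move/eqP; rewrite (@nth_uniq _ set0 vs i j (ltn_ord i) (ltn_ord j) uvs).
  by move/eqP/val_inj => ->.
pose av : 'I_10 + 'I_3 := inr (@Ordinal 3 0 isT).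
pose bv : 'I_10 + 'I_3 := inr (@Ordinal 3 1 isT).
pose tv : 'I_10 + 'I_3 := inr (@Ordinal 3 2 isT).
pose w1 : seq ('I_10 + 'I_3) := [:: av; inl a1; tv; inl t1; inl a2; inl a3; inl t2;
  inl t3; inl t4; bv; inl b1; inl b2; inl b3].
pose w2 : seq ('I_10 + 'I_3) := [:: bv; inl b1; tv; inl t3; inl b2; inl b3; inl t4;
  inl t1; inl t2; av; inl a1; inl a2; inl a3].
have w1E : abt_word1 = map dec w1 by rewrite /abt_word1 /contracted_cells /= abt_etaE.
have w2E : abt_word2 = map dec w2.
  by rewrite /abt_word2 /contracted_cells /= abt_etaE abt_vertexE.
have vE : vertex_word [:: (a1 : flag G); b1; t1] = map dec [:: av; inl a1; inl a2; inl a3;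
    bv; inl b1; inl b2; inl b3; tv; inl t1; inl t2; inl t3; inl t4].
  by rewrite /vertex_word /vertex_flags /valence /vertex /= !abt_trajectE.
have rE : perm_eq [seq vertex f | f <- [:: (a1 : flag G); b1; t1]] (enum (vertices G)).
  apply: (porbit_reps (r := [:: a1; b1; t1])); rewrite /= !abt_trajectE //.
  by elim/ord10_ind.
have ow : perm_eq (oword o) (map dec w1).
  rewrite (perm_trans (oword_cells o)) //.
  by rewrite -(permPl (vertex_word_cells rE)) vE perm_map.
rewrite w1E w2E; apply/esym/odd_koszul_shuffle => //.
rewrite /even_shuffle perm_map // koszul_map //.
by rewrite /koszul unlock.
Qed.

Lemma abt_sign (R : pzRingType) (o : orientation G) :
  (-1) ^+ (osign o + koszul predT (oword o) abt_word2) =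
  (-1) ^+ (osign o + koszul predT (oword o) abt_word1) :> R.
Proof.
have := abt_words o; move: (koszul _ _ abt_word1) (koszul _ _ abt_word2) => m n mn.
by rewrite -signr_odd oddD -mn -oddD signr_odd.
Qed.

Lemma abt_contract_a1 (k : fieldType) (nloop : vertex (a1 : flag G) != vertex (eta G a1))
    (o : orientation G) :
  Zgraph (xi_algebra k) (induced_orientation nloop o) =
  - (-1) ^+ (osign o + koszul predT (oword o) abt_word1).
Proof.
have sE : sigma G a1 = a2 by rewrite /= abt_sigmaE.
have eE : eta G a1 = t1 by rewrite /= abt_etaE.
have := @contract_xi_Zgraph k G a1 b1 nloop [:: a3; t2; t3; t4] [:: b2; b3] o.
rewrite sE eE; apply=> //.
- by rewrite /= /csigma_val eE /= !abt_sigmaE.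
- by rewrite /= /csigma_val eE /= !abt_sigmaE.
- by elim/ord10_ind.
- by rewrite /merged eE negb_or abt_vertex_neq eq_sym abt_vertex_neq.
Qed.

(** Expressed through [abt_word1] so that this contribution is literally that of (a1 t1). *)
Lemma abt_contract_b1 (k : fieldType) (nloop : vertex (b1 : flag G) != vertex (eta G b1))
    (o : orientation G) :
  Zgraph (xi_algebra k) (induced_orientation nloop o) =
  - (-1) ^+ (osign o + koszul predT (oword o) abt_word1).
Proof.
rewrite -(abt_sign k o).
have sE : sigma G b1 = b2 by rewrite /= abt_sigmaE.
have eE : eta G b1 = t3 by rewrite /= abt_etaE.
have := @contract_xi_Zgraph k G b1 a1 nloop [:: b3; t4; t1; t2] [:: a2; a3] o.
rewrite sE eE; apply=> //.
- by rewrite /= /csigma_val eE /= !abt_sigmaE.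
- by rewrite /= /csigma_val eE /= !abt_sigmaE.
- by elim/ord10_ind.
- by rewrite /merged eE abt_vertexE negb_or !abt_vertex_neq.
Qed.

(** These edges do not meet t, whose cycle of even length 4 survives the contraction. *)
Lemma abt_contract_ab (k : fieldType) (f : flag G) (nloop : vertex f != vertex (eta G f))
    (o : orientation G) : f \in [:: a2; a3] ->
  Zgraph (xi_algebra k) (induced_orientation nloop o) = 0.
Proof.
move=> fE; have tP : (t1 : flag G) \notin [:: f; eta G f].
  by case/orP: fE => [|/orP[]//] /eqP ->; rewrite /= abt_etaE.
pose x : flag (contract nloop) := Sub (t1 : flag G) tP.
have xE : [seq val y | y <- vertex_flags x] = [:: t1; t2; t3; t4].
  apply: contract_vertex_flags => //; rewrite [val x]/(t1 : flag G).
  by rewrite !inE in fE; case/orP: fE => /eqP ->;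
    rewrite /= /csigma_val /= !abt_etaE !abt_sigmaE.
apply: (@xi_Zgraph_even _ _ _ x).
by rewrite -[valence x](size_traject (csigma nloop) x) -(size_map val) xE.
Qed.

End Abt.

(** * The sum over the four non-loop edges *)

Theorem proposition16 (k : fieldType) (char_k : [pchar k] =i pred0) :
  [/\ has_genus abt_graph 1,
      punctures abt_graph = 2%N &
      forall o : orientation abt_graph,
        pairing (Z (xi_algebra k)) (D [:: (1, OGraph abt_connected o)]) != 0].
Proof.
split; [exact: abt_genus | exact: abt_punctures | move=> o].
have P (f : flag abt_graph) : f \in [:: a1; b1] ->
    (f \in froots (eta abt_graph)) && (vertex f != vertex (eta abt_graph f)).
  by rewrite mem_abt_froots !inE => /orP[]/eqP ->;
    rewrite /= abt_etaE ?abt_vertexE abt_vertex_neq.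
pose e1 : nonloop_edge abt_graph := Sub a1 (P a1 isT).
pose e2 : nonloop_edge abt_graph := Sub b1 (P b1 isT).
rewrite /pairing /D /= cats0 big_map big_enum /= (bigD1 e1) //= (bigD1 e2) //= big1 => [|e].
  rewrite addr0 !mul1r /Z /= abt_contract_a1 abt_contract_b1.
  rewrite -opprD -mulr2n oppr_eq0 -mulr_natr mulf_neq0 ?signr_eq0 //.
  (* The total is a sign times -2, and 2 is nonzero in characteristic 0. *)
  by have := char_k 2; rewrite !inE /= => ->.
case/andP => ee1 ee2; rewrite mul1r; apply: abt_contract_ab.
(* Of the five roots, a1 and b1 have been split off and t2 is excluded because (t2 t4) is a loop; a2
   and a3 remain. *)
move: (valP e) ee1 ee2; rewrite -!val_eqE /= mem_abt_froots !inE.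
by case/andP => /or4P[|||/orP[]] /eqP -> //; rewrite /= abt_etaE !abt_vertexE eqxx.
Qed.
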